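(* Let $N\ge 1$, let $D$ be a lattice (discrete subgroup with compact quotient) in $V=\mathbb{R}^{2N}$, let $D^!=\{x\in V:\epsilon(h,x)=1\ \text{for all } h\in D\}$, and let $T$ be a point of the Siegel upper half space $\mathfrak{H}_N$ (a complex symmetric $N\times N$ matrix with positive definite imaginary part). Let $f_T(x)=e^{\pi i x^tTx}$, $x\in\mathbb{R}^N$. For $h=(h_1,h_2)\in V$ put $\underline{h}:=Th_1+h_2$ and $\underline{h}^*:=\overline{T}h_1+h_2$. Then $${}_D\langle f_T,f_T\rangle=\frac{1}{\sqrt{2^N\det \mathrm{Im}\,T}}\sum_{h\in D}e^{-\frac{\pi}{2}\underline{h}^t(\mathrm{Im}\,T)^{-1}\underline{h}^*}\,e_{D,\alpha}(h),$$ $$\langle f_T,f_T\rangle_{D^!}=\frac{1}{\sqrt{2^N\det \mathrm{Im}\,T}}\sum_{h\in D^!}e^{-\frac{\pi}{2}\underline{h}^t(\mathrm{Im}\,T)^{-1}\underline{h}^*}\,e_{D^!,\bar\alpha^!}(h).$$ These scalar products are quantum theta functions $\Theta_D$, $\Theta_{D^!}$ satisfying the following functional equations: $$\forall g\in D,\quad c_g\,e_{D,\alpha}(g)\,x_g^*(\Theta_D)=\Theta_D,$$ $$\forall g\in D^!,\quad c_g^!\,e_{D^!,\bar\alpha^!}(g)\,x_g^{!*}(\Theta_{D^!})=\Theta_{D^!},$$ where $$c_g=e^{\frac{3\pi}{2}\underline{g}^t(\mathrm{Im}\,T)^{-1}\underline{g}^*},\quad x_g^*(e_{D,\alpha}(h))=e^{X_g(h)}e_{D,\alpha}(h),\quad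 X_g(h)=-\pi\,\mathrm{Re}\bigl(\underline{g}^t(\mathrm{Im}\,T)^{-1}\underline{h}^*\bigr)-\pi i\,A(g,h),$$ $$c_g^!=e^{\frac{3\pi}{2}\underline{g}^t(\mathrm{Im}\,T)^{-1}\underline{g}^*},\quad x_g^{!*}(e_{D^!,\bar\alpha^!}(h))=e^{X_g^!(h)}e_{D^!,\bar\alpha^!}(h),\quad X_g^!(h)=-\pi\,\mathrm{Re}\bigl(\underline{g}^t(\mathrm{Im}\,T)^{-1}\underline{h}^*\bigr)+\pi i\,A(g,h).$$
   Context: Vector Heisenberg setup. Write $x\in V=\mathbb{R}^{2N}$ as $x=(x_1,x_2)$ with $x_1,x_2\in\mathbb{R}^N$ (columns). Put $A(x,y)=x_1^ty_2-x_2^ty_1$, $\psi(x,y)=e^{\pi iA(x,y)}$, $\epsilon(x,y)=e^{2\pi iA(x,y)}$. The Heisenberg group $\mathbb{C}_1^*\times V$ (where $\mathbb{C}_1^*=\{z\in\mathbb{C}:|z|=1\}$) with multiplication $(\lambda,y)(\mu,z)=(\lambda\mu\psi(y,z),y+z)$ acts on $L_2(\mathbb{R}^N)$ by $(U_{(\lambda,y)}f)(x_1)=\lambda e^{2\pi i x_1^ty_2+\pi i y_1^ty_2}f(x_1+y_1)$. Quantum tori. For a free abelian group $D$ of finite rank and a skewsymmetric pairing $\alpha:D\times D\to\mathbb{C}_1^*$, $C(D,\alpha)$ is the universal $C^*$-algebra generated by unitaries $e_{D,\alpha}(h)$, $h\in D$, with $e_{D,\alpha}(g)e_{D,\alpha}(h)=\alpha(g,h)e_{D,\alpha}(g+h)$.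 Here $\alpha$ is the pairing on $D$ induced by $\epsilon$, $\alpha^!$ is the pairing on $D^!$ induced by $\epsilon$, and $\bar\alpha^!$ is the complex conjugate of $\alpha^!$. The action on $L_2(\mathbb{R}^N)$ is defined by $e_{D,\alpha}(h)f=U_{(1,h)}f$ ($h\in D$) and $e_{D^!,\alpha^!}(h)f=U_{(1,h)}f$ ($h\in D^!$). Scalar products. With $\langle\Phi,\Psi\rangle_{L_2}=\int_{\mathbb{R}^N}\Phi\overline{\Psi}\,dx_1$ (standard Haar measure), for Schwartz functions $\Phi,\Psi$ on $\mathbb{R}^N$ (and, by the same formulas, for $f_T$): $${}_D\langle\Phi,\Psi\rangle=\sum_{h\in D}\langle\Phi,e_{D,\alpha}(h)\Psi\rangle_{L_2}\,e_{D,\alpha}(h),\qquad \langle\Phi,\Psi\rangle_{D^!}=\sum_{h\in D^!}\langle e_{D^!,\alpha^!}(h)\Psi,\Phi\rangle_{L_2}\,e_{D^!,\bar\alpha^!}(h).$$ Quantum theta functions. Formal functions on the torus $T(D,\alpha)$ are formal infinite linear combinations of the $e_{D,\alpha}(h)$, $h\in D$. For $x\in\mathrm{Hom}(D,\mathbb{C}^* )$ the shift $x^*$ is the automorphism multiplying $e_{D,\alpha}(h)$ by $x(h)$. Let $\mathcal{G}(D,\alpha)$ be the group of operators on formal functions of the form $\Phi\mapsto c\,e_{D,\alpha}(g)\,x^*(\Phi)\,e_{D,\alpha}(h)^{-1}$ with $c\in\mathbb{C}^*$, $g,h\in D$, $x\in\mathrm{Hom}(D,\mathbb{C}^* )$.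 A theta multiplier is an injective homomorphism $\mathcal{L}:B\to\mathcal{G}(D,\alpha)$ with $B$ a free abelian group of the same rank as $D$; a quantum theta function with multiplier $\mathcal{L}$ is a formal function invariant under the image of $B$. (For $D^!$ the same definitions are used with $(D^!,\bar\alpha^!)$ in place of $(D,\alpha)$.)
   Formalization: The printed constants c_g, c_g^! (exponent 3π/2) make the functional equations false for g≠0; they are corrected to exponent -π/2. The pairing α is taken as ψ restricted to D (likewise D^!), as the action U_(1,h) forces, not ε. *)

(* Defs.v *)
From HB Require Import structures.
From mathcomp Require Import all_boot all_order all_algebra.
From mathcomp Require Import generic_quotient ring_quotient complex.
From mathcomp Require Import all_classical all_reals all_analysis.
From mathcomp Require Import ring.
Set Implicit Arguments.
Unset Strict Implicit.
Unset Printing Implicit Defensive.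
Import Order.TTheory GRing.Theory Num.Theory.
Import numFieldNormedType.Exports.
Local Open Scope classical_set_scope.
Local Open Scope ring_scope.
Local Open Scope complex_scope.

Section LebesgueTuple.
Context {R : realType}.
Notation RT := (measurableTypeR R).

Section step.
Variables (n : nat) (m : {sigma_finite_measure set (n.-tuple RT) -> \bar R}).

Definition cons_pair (p : RT * n.-tuple RT) : n.+1.-tuple RT :=
  [tuple of p.1 :: p.2].

Lemma measurable_cons_pair : measurable_fun setT cons_pair.
Proof. exact: (@measurable_cons _ _ _ _ fst n snd). Qed.

Definition lebesgue_cons : set (n.+1.-tuple RT) -> \bar R :=
  pushforward ((@lebesgue_measure R : set RT -> \bar R) \x m)%E cons_pair.

HB.instance Definition _ := Measure.copy lebesgue_cons
  (measure_function_pushforward__canonical__measure_function_Measure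
     ((@lebesgue_measure R : set RT -> \bar R) \x m)%E measurable_cons_pair).

Let leb_sigma_finite : sigma_finite setT lebesgue_cons.
Proof.
pose l := [the {sigma_finite_measure set RT -> \bar R} of @lebesgue_measure R].
have /sigma_finiteP[F [FT ndF Foo]] := sigma_finiteT l.
have /sigma_finiteP[G [GT ndG Goo]] := sigma_finiteT m.
pose split_cons (t : n.+1.-tuple RT) : RT * n.-tuple RT :=
  (thead t, [tuple of behead t]).
have msplit : measurable_fun setT split_cons.
  apply/measurable_fun_pairP; split; first exact: measurable_tnth.
  exact: measurable_behead.
have consK : cancel cons_pair split_cons.
  by case=> x t; rewrite /split_cons theadE; congr pair; apply: val_inj.
exists (fun k => split_cons @^-1` (F k `*` G k)) => [|k].
  rewrite -preimage_bigcup (_ : \bigcup_k _ = setT) ?preimage_setT//.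
  rewrite -setXTT FT GT predeqE => -[x y]; split.
    move=> [k _ [/= Fx Gy]].
    by split; exists k.
  move=> [/= [i _ Fx] [k _ Gy]]; exists (maxn i k) => //; split.
    by move: x Fx; exact/subsetPset/ndF/leq_maxl.
  by move: y Gy; exact/subsetPset/ndG/leq_maxr.
have [mF Fk] := Foo k; have [mG Gk] := Goo k.
have mFG : measurable (F k `*` G k) by exact: measurableX.
split; first by rewrite -[X in measurable X]setTI; exact: msplit.
rewrite /lebesgue_cons /pushforward -comp_preimage.
rewrite (_ : split_cons \o cons_pair = id); last exact/funext.
rewrite preimage_id product_measure1E// lte_mul_pinfty//.
by rewrite ge0_fin_numE.
Qed.

HB.instance Definition _ :=
  Measure_isSigmaFinite.Build _ _ _ lebesgue_cons leb_sigma_finite.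

End step.

(* Lebesgue measure on R^n, as the n-fold product of the one on R. *)
Fixpoint lebesgue_tuple n : {sigma_finite_measure set (n.-tuple RT) -> \bar R} :=
  match n with
  | 0 => dirac [tuple]
  | k.+1 => lebesgue_cons (lebesgue_tuple k)
  end.
End LebesgueTuple.

Section ComplexAnalysis.
Context {R : realType}.

Definition cexp (z : R[i]) : R[i] :=
  (expR (complex.Re z))%:C * (cos (complex.Im z) +i* sin (complex.Im z)).

Lemma cexp0 : cexp 0 = 1.
Proof. by rewrite /cexp /= expR0 cos0 sin0 mul1r. Qed.

Lemma cexpD z w : cexp (z + w) = cexp z * cexp w.
Proof.
case: z w => [a b] [c d]; rewrite /cexp /= expRD cosD sinD.
by apply/eqP; rewrite eq_complex /=; apply/andP; split; apply/eqP; ring.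
Qed.

Definition integral_Rn (n : nat) (f : 'cV[R]_n -> R[i]) : R[i] :=
  let F (t : n.-tuple (measurableTypeR R)) := f (\col_i tnth t i) in
  Rintegral (lebesgue_tuple n) setT (fun t => complex.Re (F t))
  +i* Rintegral (lebesgue_tuple n) setT (fun t => complex.Im (F t)).

Definition L2_prod (n : nat) (Phi Psi : 'cV[R]_n -> R[i]) : R[i] :=
  integral_Rn (fun x => Phi x * (Psi x)^*).

End ComplexAnalysis.

Section FormalFunctions.
Context {C : fieldType} {D : zmodType} (alpha : D -> D -> C).

(* [Phi : D -> C] stands for the formal sum of the Phi h e(h), h in D, where
   e(g) e(h) = alpha g h e(g + h). *)
Definition formal := D -> C.

Definition e_gen (h : D) : formal := fun k => (k == h)%:R.

Definition e_mull (g : D) (Phi : formal) : formal :=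
  fun k => alpha g (k - g) * Phi (k - g).

Definition e_mulr (Phi : formal) (h : D) : formal :=
  fun k => Phi (k - h) * alpha (k - h) h.

(* Right multiplication by the inverse of e(h): see [e_mulrK]. *)
Definition e_divr (Phi : formal) (h : D) : formal :=
  fun k => Phi (k + h) / alpha k h.

Lemma e_mull_gen g h : e_mull g (e_gen h) = alpha g h \*o e_gen (g + h).
Proof.
apply/funext => k; rewrite /e_mull /e_gen /= subr_eq (addrC h).
by have [->|_] := eqVneq k (g + h); rewrite ?mulr0// [g + h]addrC addrK.
Qed.

Lemma e_mulr_gen g h : e_mulr (e_gen g) h = alpha g h \*o e_gen (g + h).
Proof.
apply/funext => k; rewrite /e_mulr /e_gen /= subr_eq mulrC.
by have [->|_] := eqVneq k (g + h); rewrite ?mulr0// addrK.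
Qed.

Lemma e_mulrK h : (forall k, alpha k h != 0) ->
  cancel (e_mulr^~ h) (e_divr^~ h) /\ cancel (e_divr^~ h) (e_mulr^~ h).
Proof.
move=> a0; split=> Phi; apply/funext => k; rewrite /e_mulr /e_divr.
  by rewrite addrK mulfK.
by rewrite subrK mulfVK.
Qed.

Definition is_torus_point (x : D -> C) :=
  (forall h, x h != 0) /\ (forall g h, x (g + h) = x g * x h).

Definition torus_shift (x : D -> C) (Phi : formal) : formal := fun h => x h * Phi h.

Definition in_theta_group (G : formal -> formal) :=
  exists (c : C) (g h : D) (x : D -> C), [/\ c != 0, is_torus_point x &
    forall Phi, G Phi = c \*o e_divr (e_mull g (torus_shift x Phi)) h].

Definition free_of_rank (B : zmodType) (r : nat) :=
  exists b : 'I_r -> B,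
    forall x, exists! z : {ffun 'I_r -> int}, x = \sum_i b i *~ z i.

Definition theta_multiplier (B : zmodType) (L : B -> formal -> formal) :=
  [/\ exists r, free_of_rank B r /\ free_of_rank D r,
      forall b, in_theta_group (L b),
      forall a b, L (a + b) = L a \o L b &
      injective L].

Definition quantum_theta (B : zmodType) (L : B -> formal -> formal)
    (Theta : formal) :=
  theta_multiplier L /\ forall b, L b Theta = Theta.

Lemma theta_constant_unique c g x Theta :
  alpha g 0 = 1 -> x 0 = 1 -> Theta 0 != 0 ->
  c \*o e_mull g (torus_shift x Theta) = Theta -> c = Theta g / Theta 0.
Proof.
move=> ag x0 T0 /(congr1 (@^~ g)).
rewrite /= /e_mull /torus_shift subrr ag x0 !mul1r => <-.
by rewrite mulfK.
Qed.

End FormalFunctions.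
Arguments formal : clear implicits.

Section Heisenberg.
Context {R : realType} {N : nat}.
Notation C := R[i].

Definition V : Type := ('cV[R]_N * 'cV[R]_N)%type.
HB.instance Definition _ := NormedModule.on V.

Definition pairA (x y : V) : R :=
  (x.1^T *m y.2) 0 0 - (x.2^T *m y.1) 0 0.

Definition psi (x y : V) : C := cexp ('i * (pi * pairA x y)%:C).
Definition eps_pair (x y : V) : C := cexp ('i * (2 * pi * pairA x y)%:C).

Definition heis_mul (a b : C * V) : C * V :=
  (a.1 * b.1 * psi a.2 b.2, a.2 + b.2).

Definition heis_act (a : C * V) (f : 'cV[R]_N -> C) : 'cV[R]_N -> C :=
  fun x => a.1
    * cexp ('i * (2 * pi * (x^T *m a.2.2) 0 0 + pi * (a.2.1^T *m a.2.2) 0 0)%:C)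
    * f (x + a.2.1).

Lemma heis_act_mul a b f : heis_act (heis_mul a b) f = heis_act a (heis_act b f).
Proof.
case: a b => [l [y1 y2]] [m [z1 z2]]; apply/funext => x.
rewrite /heis_act /heis_mul /psi /=.
have -> : x + (y1 + z1) = x + y1 + z1 by rewrite addrA.
set E1 := 'i * _; set E2 := 'i * _; set E3 := 'i * _; set E4 := 'i * _.
have E : cexp E1 * cexp E2 = cexp E3 * cexp E4.
  rewrite -!cexpD /E1 /E2 /E3 /E4 -!mulrDr -!(raddfD (real_complex R)).
  congr (cexp (_ * _%:C)); rewrite /pairA /=.
  have -> : (y2^T *m z1) 0 0 = (z1^T *m y2) 0 0.
    by rewrite -[LHS]trace_mx11 -mxtrace_tr trmx_mul trmxK trace_mx11.
  have mxD (A B : 'M[R]_1) : (A + B) 0 0 = A 0 0 + B 0 0 by rewrite mxE.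
  by rewrite !linearD /= !mulmxDl !mxD; ring.
have F (u v w t l' m' f' : C) : u * v = w * t ->
    l' * m' * u * v * f' = l' * w * (m' * t * f').
  by move=> uv; rewrite -(mulrA (l' * m')) uv; ring.
exact: F.
Qed.

(* Subgroups of V are [zmodClosed] predicates; the following is the group of
   their elements. *)
Definition points (D : zmodClosed V) := {x : V | x \in D}.
HB.instance Definition _ (D : zmodClosed V) := SubChoice.on (points D).
HB.instance Definition _ (D : zmodClosed V) :=
  [SubChoice_isSubZmodule of points D by <:].

Definition is_lattice (D : zmodClosed V) :=
  (forall h, h \in D -> isolated [set x | x \in D] h) /\
  compact [set: quotient_topology (Quotient.quot D)].

Definition orth (D : {pred V}) : {pred V} :=
  [pred x | `[< forall h, h \in D -> eps_pair h x = 1 >]].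

Lemma orth_zmod_closed D : zmod_closed (orth D).
Proof.
split=> [|x y].
  apply: asboolT => h _.
  by rewrite /eps_pair /pairA !mulmx0 !mxE subrr mulr0 mulr0 cexp0.
move=> /asboolW xD /asboolW yD; apply: asboolT => h hD.
have : eps_pair h (x - y) * eps_pair h y = eps_pair h x.
  rewrite -cexpD -mulrDr -(raddfD (real_complex R)) -mulrDr.
  congr (cexp (_ * (_ * _)%:C)).
  have mxB (A B : 'M[R]_1) : (A - B) 0 0 = A 0 0 - B 0 0 by rewrite !mxE.
  by rewrite /pairA /= !mulmxBr !mxB; ring.
by rewrite (yD h hD) (xD h hD) mulr1.
Qed.

HB.instance Definition _ (D : {pred V}) :=
  GRing.isZmodClosed.Build V (orth D) (orth_zmod_closed D).

Definition dual_lattice (D : zmodClosed V) : zmodClosed V :=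
  [the zmodClosed V of orth D].

(* The values U_(1,h) of the e(h) on L_2(R^N) satisfy [e_act_mul], so the
   pairing alpha with e(g) e(h) = alpha(g,h) e(g+h) is the restriction of psi,
   and eps_pair is the commutation pairing,
   e(g) e(h) = eps_pair(g,h) e(h) e(g). *)
Definition alpha (D : zmodClosed V) (g h : points D) : C :=
  psi (val g) (val h).

Definition alpha_conj (D : zmodClosed V) (g h : points D) : C := (alpha g h)^*.

Definition e_act (D : zmodClosed V) (h : points D) :
    ('cV[R]_N -> C) -> 'cV[R]_N -> C := heis_act (1, val h).

Lemma e_act_mul (D : zmodClosed V) (g h : points D) f :
  e_act g (e_act h f) = alpha g h \*o e_act (g + h) f.
Proof.
rewrite /e_act -heis_act_mul /heis_mul /= !mul1r.
by apply/funext => x; rewrite /heis_act /alpha /= mul1r mulrA.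
Qed.

(* The formal sums over h of these coefficients times e(h). *)
Definition scal_left (D : zmodClosed V) (Phi Psi : 'cV[R]_N -> C) :
    formal C (points D) :=
  fun h => L2_prod Phi (e_act h Psi).

Definition scal_right (D : zmodClosed V) (Phi Psi : 'cV[R]_N -> C) :
    formal C (points (dual_lattice D)) :=
  fun h => L2_prod (e_act h Psi) Phi.

Definition real_mx m n (M : 'M[R]_(m, n)) : 'M[C]_(m, n) :=
  map_mx (real_complex R) M.

Definition im_mx (T : 'M[C]_N) : 'M[R]_N := map_mx (@complex.Im R) T.

Definition siegel (T : 'M[C]_N) :=
  T^T = T /\
  forall x : 'cV[R]_N, x != 0 -> 0 < (x^T *m im_mx T *m x) 0 0.

Definition f_T (T : 'M[C]_N) (x : 'cV[R]_N) : C :=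
  cexp ('i * pi%:C * ((real_mx x)^T *m T *m real_mx x) 0 0).

Definition uline (T : 'M[C]_N) (h : V) : 'cV[C]_N :=
  T *m real_mx h.1 + real_mx h.2.

Definition uline_conj (T : 'M[C]_N) (h : V) : 'cV[C]_N :=
  map_mx conjc T *m real_mx h.1 + real_mx h.2.

Definition herm (T : 'M[C]_N) (g h : V) : C :=
  ((uline T g)^T *m real_mx (invmx (im_mx T)) *m uline_conj T h) 0 0.

Definition theta_series (T : 'M[C]_N) (D : zmodClosed V) :
    formal C (points D) :=
  fun h => (Num.sqrt (2 ^+ N * \det (im_mx T)))^-1%:C
           * cexp (- (pi / 2)%:C * herm T (val h) (val h)).
Arguments theta_series T D : clear implicits.

(* [theta_c_unique] below: no other constant is possible in the functional
   equation of the theta series. In particular the exponent cannot be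
   3 pi / 2 times [herm T g g], which is positive for g <> 0. *)
Definition theta_c (T : 'M[C]_N) (g : V) : C :=
  cexp (- (pi / 2)%:C * herm T g g).

Definition theta_X (T : 'M[C]_N) (g h : V) : C :=
  - (pi * complex.Re (herm T g h))%:C - 'i * (pi * pairA g h)%:C.

Definition theta_X_dual (T : 'M[C]_N) (g h : V) : C :=
  - (pi * complex.Re (herm T g h))%:C + 'i * (pi * pairA g h)%:C.

Definition theta_mult (T : 'M[C]_N) (D : zmodClosed V) (g : points D)
    (Phi : formal C (points D)) : formal C (points D) :=
  theta_c T (val g)
  \*o e_mull (@alpha D) g
        (torus_shift (fun h => cexp (theta_X T (val g) (val h))) Phi).
Arguments theta_mult T D : clear implicits.

Definition theta_mult_dual (T : 'M[C]_N) (D : zmodClosed V)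
    (g : points (dual_lattice D)) (Phi : formal C (points (dual_lattice D))) :
    formal C (points (dual_lattice D)) :=
  theta_c T (val g)
  \*o e_mull (@alpha_conj (dual_lattice D)) g
        (torus_shift (fun h => cexp (theta_X_dual T (val g) (val h))) Phi).
Arguments theta_mult_dual T D : clear implicits.

Lemma theta_c_unique (T : 'M[C]_N) (D : zmodClosed V) (g : points D) c :
  0 < \det (im_mx T) ->
  c \*o e_mull (@alpha D) g
        (torus_shift (fun h => cexp (theta_X T (val g) (val h)))
           (theta_series T D))
  = theta_series T D ->
  c = theta_c T (val g).
Proof.
move=> detT.
have ul0 (M : 'M[C]_N) : M *m real_mx (0 : V).1 + real_mx (0 : V).2 = 0.
  by rewrite /real_mx !map_mx0 mulmx0 addr0.
have herm0 h : herm T h 0 = 0 by rewrite /herm /uline_conj ul0 mulmx0 mxE.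
have A0 h : pairA h (0 : V) = 0 by rewrite /pairA !mulmx0 !mxE subrr.
have k0 : (Num.sqrt (2 ^+ N * \det (im_mx T)))^-1%:C != 0.
  by rewrite fmorph_eq0 invr_eq0 sqrtr_eq0 -ltNge mulr_gt0// exprn_gt0.
have T0 : theta_series T D 0
    = (Num.sqrt (2 ^+ N * \det (im_mx T)))^-1%:C.
  by rewrite /theta_series /= herm0 mulr0 cexp0 mulr1.
move/theta_constant_unique => -> //.
- by rewrite T0 /theta_series /theta_c mulrC mulKf.
- by rewrite /alpha /psi /= A0 !mulr0 cexp0.
- by rewrite /theta_X /= herm0 A0 !mulr0 oppr0 add0r cexp0.
- by rewrite T0.
Qed.

End Heisenberg.
Arguments V : clear implicits.
Arguments theta_series {R N} T D.
Arguments theta_mult {R N} T D.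
Arguments theta_mult_dual {R N} T D.
Arguments scal_left {R N} D Phi Psi.
Arguments scal_right {R N} D Phi Psi.

(* Main.v *)
(* The integrand of the product of f_T and e(h) f_T is a constant times the
   Gaussian exp (- pi (x - u)^t (2 Im T) (x - u)) with a complex centre u. Its
   integral does not depend on u: in dimension one, the derivative with respect
   to Im u is, by the Cauchy-Riemann equations, the integral of a derivative in
   x, hence zero; integrating out one variable at a time then reduces 2 Im T to
   its Schur complements. Completing the square, the coefficient at h is a
   constant times exp (- pi/2 H(h,h)) for the hermitian form
   H(g,h) = g^t (Im T)^-1 h^*, and the functional equations amount to
   H(g+h,g+h) = H(g,g) + 2 Re H(g,h) + H(h,h), the phases of e(g) and x_g^*
   cancelling out.
   A theta multiplier also requires the lattices to be free of finite rank. A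
   linear functional vanishing on D is bounded on the compact quotient V/D,
   hence zero, so D contains a real basis b of V. Pairing with b embeds the dual
   lattice into Z^2N. By simultaneous approximation and discreteness the
   coordinates of D in b have bounded denominators, so that D embeds into Z^2N
   too; and every subgroup of Z^m is free. *)
Require Import Defs.
From HB Require Import structures.
From mathcomp Require Import all_boot all_order all_algebra.
From mathcomp Require Import archimedean generic_quotient ring_quotient.
From mathcomp Require Import complex all_classical all_reals all_analysis.
From mathcomp Require Import measurable_realfun normal_distribution.
From mathcomp Require Import ring lra.
Import Order.TTheory GRing.Theory Num.Theory.
Import numFieldNormedType.Exports.
Set Implicit Arguments.
Unset Strict Implicit.
Unset Printing Implicit Defensive.
Local Open Scope classical_set_scope.
Local Open Scope complex_scope.
Local Open Scope ring_scope.

(** * Gaussian integrals with complex centre *)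

Section integral_derivative.
Context {R : realType}.
Local Notation mu := (@lebesgue_measure R).

(** Dominated convergence, with [|f|] as the bound, along symmetric intervals on which the
    fundamental theorem of calculus gives a difference of values of [F]. *)
Lemma integral_derivative_eq0 (F f : R -> R) :
  (forall x : R, is_derive x (1:R) F (f x)) -> continuous f ->
  mu.-integrable setT (EFin \o f) ->
  F n%:R @[n --> \oo] --> 0 -> F (- n%:R) @[n --> \oo] --> 0 ->
  (\int[mu]_x f x)%R = 0.
Proof.
move=> dF cf intf Fy FNy.
(* [n.+1] keeps the interval nondegenerate, as [continuous_FTC2] requires; the two limits are
   shifted accordingly. *)
pose I (n : nat) : set R := `[- n.+1%:R, n.+1%:R]%classic.
pose f_ n := EFin \o (f \_ (I n)).
have mI n : measurable (I n) by exact: measurable_itv.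
have mf : measurable_fun setT f by exact: continuous_measurable_fun.
have mfI n : measurable_fun setT (f \_ (I n)).
  have [+ _] := measurable_restrictT f (mI n).
  by apply; exact: measurable_funTS.
have cF : continuous F.
  by move=> x; apply/differentiable_continuous/derivable1_diffP; case: (dF x).
have [|||||_ _] := @dominated_convergence _ _ R mu setT measurableT f_
    (EFin \o f) (fun x => `|(f x)%:E|%E).
- by move=> n; apply/measurable_EFinP; exact: mfI n.
- exact/measurable_EFinP.
- apply: aeW => /= x _; apply: cvg_near_cst.
  exists (Num.bound `|x|) => // n /= xn; rewrite /f_/= patchE mem_set//.
  rewrite /I/= in_itv/= -ler_norml ltW// (lt_le_trans (archi_boundP _))//.
  by rewrite ler_nat leqW.
- exact: integrable_abse.
- apply: aeW => /= x n _; rewrite /f_/= patchE.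
  by case: ifPn => // _; rewrite normr0 lee_fin.
have -> : [sequence (\int[mu]_(x in setT) f_ n x)%E]_n
    = fun n => (F n.+1%:R - F (- n.+1%:R))%:E.
  apply/funext => n; rewrite /f_/=.
  have n0 : - n.+1%:R < n.+1%:R :> R by apply: gtrN; rewrite ltr0n.
  transitivity (\int[mu]_(x in I n) (f x)%:E)%E.
    by rewrite [in RHS]integral_mkcond restrict_EFin.
  rewrite (@continuous_FTC2 _ f F)//.
  - exact: continuous_subspaceT.
  - split => [x _| |]; first by case: (dF x).
    + by apply: cvg_at_right_filter; exact: cF.
    + by apply: cvg_at_left_filter; exact: cF.
  - by move=> x _; rewrite derive1E; apply: derive_val.
have : (F n.+1%:R - F (- n.+1%:R))%:E @[n --> \oo] --> (0%:E : \bar R).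
  apply: cvg_EFin; first exact: nearW.
  rewrite -[0](subrr 0); apply: cvgB.
    by rewrite -(cvg_shiftS (fun n => F n%:R)) in Fy.
  by rewrite -(cvg_shiftS (fun n => F (- n%:R))) in FNy.
by move=> F0 /(cvg_unique (@ereal_hausdorff R) F0); rewrite /Rintegral/= => <-.
Qed.
End integral_derivative.

Lemma integrable_dominated d (T : measurableType d) (R : realType)
    (mu : {measure set T -> \bar R}) (K : R) (f g : T -> R) :
  measurable_fun setT f -> (forall x, `|f x| <= K * g x) ->
  mu.-integrable setT (EFin \o g) -> mu.-integrable setT (EFin \o f).
Proof.
move=> mf fg /(integrableZl measurableT K).
apply: le_integrable => //; first exact/measurable_EFinP.
by move=> x _ /=; rewrite lee_fin (le_trans (fg x))// ler_norm.
Qed.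

(** * Gaussian integrals on the line *)

Section gauss_line.
Context {R : realType}.
Local Notation mu := (@lebesgue_measure R).
Implicit Types c p q s k : R.

Definition gauss c p s := expR (- (c * (s - p) ^+ 2)).

(** Up to the factor sqrt (pi / c), this is the normal density of variance 1 / (2c), which supplies
    both integrability and the value of the integral. *)
Lemma gauss_normal c p : 0 < c ->
  gauss c p =
    (fun s => Num.sqrt (pi / c) * normal_pdf p (Num.sqrt (2 * c))^-1 s).
Proof.
move=> c0; apply/funext => s.
have s0 : (Num.sqrt (2 * c))^-1 != 0.
  by rewrite invr_eq0 gt_eqF// sqrtr_gt0 mulr_gt0.
rewrite normal_pdfE// /normal_peak exprVn sqr_sqrtr ?mulr_ge0 ?(ltW c0)//.
rewrite (_ : (2 * c)^-1 * pi *+ 2 = pi / c); last by field; rewrite gt_eqF.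
rewrite mulVKf; last by rewrite gt_eqF// sqrtr_gt0 divr_gt0// pi_gt0.
rewrite /normal_fun exprVn sqr_sqrtr ?mulr_ge0 ?(ltW c0)//.
by rewrite /gauss; congr expR; field; rewrite gt_eqF.
Qed.

Lemma integrable_gauss c p : 0 < c -> mu.-integrable setT (EFin \o gauss c p).
Proof.
move=> c0; rewrite gauss_normal//.
have := integrable_normal_pdf p (Num.sqrt (2 * c))^-1.
by move=> /(integrableZl measurableT (Num.sqrt (pi / c))).
Qed.

Lemma Rintegral_gauss c p : 0 < c ->
  (\int[mu]_s gauss c p s)%R = Num.sqrt (pi / c).
Proof.
move=> c0; rewrite gauss_normal// RintegralZl//; last first.
  exact: integrable_normal_pdf.
by rewrite /Rintegral integral_normal_pdf mulr1.
Qed.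

(** The phase [k] lets one function stand for the real part (k = 0) and the imaginary part (k = - pi
    / 2) of exp (- c (s - p - iq)^2). *)
Definition gwave k c p q s :=
  expR (- (c * ((s - p) ^+ 2 - q ^+ 2))) * cos (2 * c * q * (s - p) + k).

Let swave k c p q s :=
  expR (- (c * ((s - p) ^+ 2 - q ^+ 2))) * sin (2 * c * q * (s - p) + k).

Let dwave k c p q s :=
  expR (- (c * ((s - p) ^+ 2 - q ^+ 2))) *
    (2 * c * q * cos (2 * c * q * (s - p) + k)
     - 2 * c * (s - p) * sin (2 * c * q * (s - p) + k)).

(* The wave is the real part of exp (- c (s - p - iq)^2 + ik), hence analytic
   in s - iq: by the Cauchy-Riemann equations, its derivative in q is the
   derivative in s of its conjugate. *)
Let is_derive_gwave k c p q s :
  is_derive q (1:R) (fun q => gwave k c p q s) (dwave k c p q s).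
Proof.
rewrite /gwave; apply: is_derive_eq.
rewrite /dwave /GRing.scale/=; ring.
Qed.

Let is_derive_swave k c p q s :
  is_derive s (1:R) (swave k c p q) (dwave k c p q s).
Proof.
rewrite /swave; apply: is_derive_eq.
rewrite /dwave /GRing.scale/=; ring.
Qed.

Let continuous_gwave k c p q : continuous (gwave k c p q).
Proof.
move=> s; apply/differentiable_continuous/derivable1_diffP.
by rewrite /gwave; apply: ex_derive.
Qed.

Let continuous_dwave k c p q : continuous (dwave k c p q).
Proof.
move=> s; apply/differentiable_continuous/derivable1_diffP.
by rewrite /dwave; apply: ex_derive.
Qed.

Let expR_split c p q s :
  expR (- (c * ((s - p) ^+ 2 - q ^+ 2))) = expR (c * q ^+ 2) * gauss c p s.
Proof. by rewrite /gauss -expRD; congr expR; ring. Qed.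

Let abs_gwave k c p q s :
  `|gwave k c p q s| <= expR (c * q ^+ 2) * gauss c p s.
Proof.
rewrite /gwave expR_split normrM ger0_norm ?mulr_ge0 ?expR_ge0//.
rewrite ler_piMr ?mulr_ge0 ?expR_ge0//.
by rewrite ler_norml cos_geN1 cos_le1.
Qed.

Let abs_swave k c p q s :
  `|swave k c p q s| <= expR (c * q ^+ 2) * gauss c p s.
Proof.
rewrite /swave expR_split normrM ger0_norm ?mulr_ge0 ?expR_ge0//.
rewrite ler_piMr ?mulr_ge0 ?expR_ge0//.
by rewrite ler_norml sin_geN1 sin_le1.
Qed.

(** The bound is uniform for [q] in [-Q, Q], as differentiation under the integral sign requires.
    Half of the Gaussian is spent on absorbing the linear factor |q| + |s - p|. *)
Let abs_dwave k c p Q q s : 0 < c -> `|q| <= Q ->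
  `|dwave k c p q s|
    <= (2 * c * (Q + 1 + 2 / c) * expR (c * Q ^+ 2)) * gauss (c / 2) p s.
Proof.
move=> c0 qQ; have Q0 : 0 <= Q by exact: le_trans qQ.
set t := s - p; have ge0 := @expR_ge0 R.
(* Combines |t| <= 1 + t^2 with 1 + v <= exp v at v = c t^2 / 2; the summand 2 / c turns v back into
   t^2. *)
have h : `|q| + `|t| <= (Q + 1 + 2 / c) * expR (c / 2 * t ^+ 2).
  have t2 : `|t| <= 1 + t ^+ 2.
    by rewrite -[t ^+ 2]real_normK ?num_real//; nra.
  have E : 1 + c / 2 * t ^+ 2 <= expR (c / 2 * t ^+ 2) := expR_ge1Dx _.
  have c2 : 0 < 2 / c by rewrite divr_gt0.
  apply: (@le_trans _ _ ((Q + 1 + 2 / c) * (1 + c / 2 * t ^+ 2))); last first.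
    by apply: ler_wpM2l => //; lra.
  have ct : 0 <= c / 2 * t ^+ 2 by rewrite mulr_ge0 ?sqr_ge0 ?divr_ge0 ?ltW.
  have -> : (Q + 1 + 2 / c) * (1 + c / 2 * t ^+ 2)
      = Q + 1 + 2 / c + (Q + 1) * (c / 2 * t ^+ 2) + t ^+ 2.
    by field; rewrite gt_eqF.
  have : 0 <= (Q + 1) * (c / 2 * t ^+ 2) by rewrite mulr_ge0// addr_ge0.
  by move: qQ t2 c2; lra.
rewrite /dwave normrM ger0_norm// expR_split -/t.
rewrite (_ : gauss c p s = gauss (c / 2) p s * gauss (c / 2) p s); last first.
  by rewrite /gauss -expRD; congr expR; field.
have -> : 2 * c * (Q + 1 + 2 / c) * expR (c * Q ^+ 2) * gauss (c / 2) p s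
    = (expR (c * Q ^+ 2) * (gauss (c / 2) p s * gauss (c / 2) p s))
      * (2 * c * ((Q + 1 + 2 / c) * expR (c / 2 * t ^+ 2))).
  have EG : expR (c / 2 * t ^+ 2) * gauss (c / 2) p s = 1.
    by rewrite /gauss -expRD subrr expR0.
  by rewrite -[LHS]mulr1 -[X in _ * X = _]EG; ring.
apply: ler_pM => //; first by rewrite !mulr_ge0 ?expR_ge0.
  apply: ler_wpM2r; first by rewrite mulr_ge0 ?expR_ge0.
  rewrite ler_expR ler_pM2l// -[q ^+ 2]real_normK ?num_real//.
  by rewrite ler_sqr ?nnegrE.
apply: (@le_trans _ _ (2 * c * (`|q| + `|t|))); last first.
  by rewrite ler_pM2l// mulr_gt0.
apply: (le_trans (ler_normB _ _)); rewrite [leRHS]mulrDr; apply: lerD.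
  rewrite !normrM (ger0_norm (ltW c0)) normr_nat ler_piMr ?mulr_ge0 ?(ltW c0)//.
  by rewrite ler_norml cos_geN1 cos_le1.
rewrite !normrM (ger0_norm (ltW c0)) normr_nat ler_piMr ?mulr_ge0 ?(ltW c0)//.
by rewrite ler_norml sin_geN1 sin_le1.
Qed.

Lemma integrable_gwave k c p q : 0 < c ->
  mu.-integrable setT (EFin \o gwave k c p q).
Proof.
move=> c0; apply: integrable_dominated.
- exact: continuous_measurable_fun.
- exact: abs_gwave.
- exact: integrable_gauss.
Qed.

Let integrable_dwave k c p q : 0 < c ->
  mu.-integrable setT (EFin \o dwave k c p q).
Proof.
move=> c0; apply: integrable_dominated.
- exact: continuous_measurable_fun.
- by move=> s; apply: (@abs_dwave _ _ _ `|q|).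
- by apply: integrable_gauss; rewrite divr_gt0.
Qed.

Let cvg_gauss_nat c p : 0 < c ->
  gauss c p n%:R @[n --> \oo] --> 0 /\ gauss c p (- n%:R) @[n --> \oo] --> 0.
Proof.
move=> c0.
have gE s : gauss c p s = gauss_fun (Num.sqrt c * (s - p)).
  by rewrite /gauss /gauss_fun exprMn sqr_sqrtr// ltW.
have sc0 : 0 < Num.sqrt c by rewrite sqrtr_gt0.
have lim (r : R) : Num.sqrt c * (n%:R + r) @[n --> \oo] --> +oo.
  apply/cvgryPge => A; near=> n.
  rewrite -ler_pdivrMl// -lerBlDr.
  near: n; exact: nbhs_infty_ger.
split; under eq_fun do rewrite gE.
  exact: cvg_comp (lim (- p)) cvg_gauss_fun.
under eq_fun => n.
  rewrite (_ : gauss_fun _ = gauss_fun (Num.sqrt c * (n%:R + p))); last first.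
    by rewrite /gauss_fun; congr (expR (- _)); ring.
  over.
exact: cvg_comp (lim p) cvg_gauss_fun.
Unshelve. all: by end_near. Qed.

Let Rintegral_dwave k c p q : 0 < c -> (\int[mu]_s dwave k c p q s)%R = 0.
Proof.
move=> c0; apply: (@integral_derivative_eq0 _ (swave k c p q)) => //.
- exact: integrable_dwave.
- apply/norm_cvg0P; apply: (@squeeze_cvgr _ _ _ _ (cst 0)
    (fun n => expR (c * q ^+ 2) * gauss c p n%:R)) => //.
  + by near=> n; rewrite normr_ge0 abs_swave.
  + exact: cvg_cst.
  + rewrite -[0](mulr0 (expR (c * q ^+ 2))); apply: cvgM; first exact: cvg_cst.
    by case: (cvg_gauss_nat p c0).
- apply/norm_cvg0P; apply: (@squeeze_cvgr _ _ _ _ (cst 0)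
    (fun n => expR (c * q ^+ 2) * gauss c p (- n%:R))) => //.
  + by near=> n; rewrite normr_ge0 abs_swave.
  + exact: cvg_cst.
  + rewrite -[0](mulr0 (expR (c * q ^+ 2))); apply: cvgM; first exact: cvg_cst.
    by case: (cvg_gauss_nat p c0).
Unshelve. all: by end_near. Qed.

(** The derivative in [q] is the integral of [dwave], hence 0; so [q] may be taken to be 0, where
    the wave is [cos k] times a real Gaussian. *)
Lemma Rintegral_gwave k c p q : 0 < c ->
  (\int[mu]_s gwave k c p q s)%R = cos k * Num.sqrt (pi / c).
Proof.
move=> c0; pose F x := (\int[mu]_s gwave k c p x s)%R.
have -> : cos k * Num.sqrt (pi / c) = F 0.
  rewrite -(@Rintegral_gauss c p)// mulrC -RintegralZr//; last first.
    exact: integrable_gauss.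
  apply: eq_Rintegral => s _; rewrite /gwave /gauss.
  by congr (expR _ * cos _); ring.
rewrite -/(F q); apply: is_derive_0_is_cst => {}q.
have dE x s : partial1of2 (gwave k c p) x s = dwave k c p x s.
  by rewrite partial1of2E; apply: derive_val.
(* Differentiability is local, so [q] may be confined to a bounded open interval, on which
   [abs_dwave] provides one integrable bound [G]. *)
pose Q := `|q| + 1.
have I x : x \in `]- Q, Q[ -> `|x| <= Q.
  by rewrite in_itv/= ler_norml => /andP[/ltW-> /ltW->].
have Iq : `]- Q, Q[%classic q.
  by rewrite /= in_itv/= -ltr_norml ltrDl.
pose K := 2 * c * (Q + 1 + 2 / c) * expR (c * Q ^+ 2).
pose G s := K * gauss (c / 2) p s.
have G0 s : 0 <= G s.
  have qQ : `|q| <= Q by rewrite lerDl.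
  exact: le_trans (normr_ge0 _) (abs_dwave k p s c0 qQ).
have intF x : `]- Q, Q[%classic x ->
    mu.-integrable setT (EFin \o gwave k c p x).
  by move=> _; exact: integrable_gwave.
have derF x s : `]- Q, Q[%classic x -> setT s ->
    derivable (gwave k c p ^~ s) x 1.
  by move=> _ _; case: (is_derive_gwave k c p x s).
have intG : mu.-integrable setT (EFin \o G).
  rewrite (_ : _ \o _ = fun s => (K%:E * (EFin \o gauss (c / 2) p) s)%E)//.
  by apply: integrableZl => //; apply: integrable_gauss; rewrite divr_gt0.
have bound x s : `]- Q, Q[%classic x -> setT s ->
    `|partial1of2 (gwave k c p) x s| <= G s.
  by move=> xQ _; rewrite dE; apply: abs_dwave => //; exact: I.
have dF := derivable_under_integral measurableT Iq intF derF G0 intG bound.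
apply: DeriveDef => //; rewrite -derive1E.
rewrite (differentiation_under_integral measurableT Iq intF derF G0 intG bound).
under eq_Rintegral do rewrite dE.
exact: Rintegral_dwave.
Qed.
End gauss_line.

(** * Measurability, integration and Fubini's theorem for complex-valued functions *)

Section complex_integral.
Context {R : realType}.
Local Notation C := R[i].

Section measurability.
Context d (T : measurableType d).
Implicit Types f g : T -> C.

Definition cmeasurable f :=
  measurable_fun setT (fun x => complex.Re (f x)) /\
  measurable_fun setT (fun x => complex.Im (f x)).

Lemma cmeasurable_cst (k : C) : cmeasurable (fun=> k).
Proof. by split; exact: measurable_cst. Qed.

Lemma cmeasurable_real (f : T -> R) :
  measurable_fun setT f -> cmeasurable (fun x => (f x)%:C).
Proof. by move=> mf; split => //=; exact: measurable_cst. Qed.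

Lemma cmeasurableD f g :
  cmeasurable f -> cmeasurable g -> cmeasurable (fun x => f x + g x).
Proof.
move=> [f1 f2] [g1 g2]; split.
  rewrite (_ : (fun _ => _) =
    (fun x => complex.Re (f x)) \+ (fun x => complex.Re (g x))).
    exact: measurable_funD.
  by apply/funext => x /=; case: (f x) (g x) => [? ?] [? ?].
rewrite (_ : (fun _ => _) =
  (fun x => complex.Im (f x)) \+ (fun x => complex.Im (g x))).
  exact: measurable_funD.
by apply/funext => x /=; case: (f x) (g x) => [? ?] [? ?].
Qed.

Lemma cmeasurableM f g :
  cmeasurable f -> cmeasurable g -> cmeasurable (fun x => f x * g x).
Proof.
move=> [f1 f2] [g1 g2]; split.
  rewrite (_ : (fun _ => _) =
    ((fun x => complex.Re (f x)) \* (fun x => complex.Re (g x))) \-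
    ((fun x => complex.Im (f x)) \* (fun x => complex.Im (g x)))).
    by apply: measurable_funB; exact: measurable_funM.
  by apply/funext => x /=; case: (f x) (g x) => [? ?] [? ?].
rewrite (_ : (fun _ => _) =
  ((fun x => complex.Re (f x)) \* (fun x => complex.Im (g x))) \+
  ((fun x => complex.Im (f x)) \* (fun x => complex.Re (g x)))).
  by apply: measurable_funD; exact: measurable_funM.
by apply/funext => x /=; case: (f x) (g x) => [? ?] [? ?].
Qed.

Lemma cmeasurable_sum (I : Type) (r : seq I) (F : I -> T -> C) :
  (forall i, cmeasurable (F i)) -> cmeasurable (fun x => \sum_(i <- r) F i x).
Proof.
move=> mF; elim: r => [|i r IH].
  under [X in cmeasurable X]eq_fun do rewrite big_nil.
  exact: cmeasurable_cst.
under [X in cmeasurable X]eq_fun do rewrite big_cons.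
exact: cmeasurableD.
Qed.

Lemma cmeasurable_cexp f : cmeasurable f -> cmeasurable (fun x => cexp (f x)).
Proof.
move=> [f1 f2].
have mexp : measurable_fun setT (fun x => expR (complex.Re (f x))).
  exact: measurableT_comp.
have mcos : measurable_fun setT (fun x => cos (complex.Im (f x))).
  apply: measurableT_comp => //.
  by apply: continuous_measurable_fun; exact: continuous_cos.
have msin : measurable_fun setT (fun x => sin (complex.Im (f x))).
  apply: measurableT_comp => //.
  by apply: continuous_measurable_fun; exact: continuous_sin.
rewrite /cexp; apply: cmeasurableM; first exact: cmeasurable_real.
by split.
Qed.
End measurability.

Lemma cmeasurable_comp d d' (T : measurableType d) (T' : measurableType d')
    (h : T' -> T) (f : T -> C) :
  measurable_fun setT h -> cmeasurable f -> cmeasurable (f \o h).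
Proof.
by move=> mh [f1 f2]; split;
  [exact: (measurableT_comp f1)|exact: (measurableT_comp f2)].
Qed.

Section integral.
Context d (T : measurableType d) (mu : {measure set T -> \bar R}).
Implicit Types f : T -> C.

Definition cintegrable f :=
  mu.-integrable setT (EFin \o (fun x => complex.Re (f x))) /\
  mu.-integrable setT (EFin \o (fun x => complex.Im (f x))).

(** [integral_Rn] is, up to conversion, the case of [lebesgue_tuple n]; other measures occur in the
    inner integrals and on products. *)
Definition cintegral f : C :=
  Rintegral mu setT (fun x => complex.Re (f x))
  +i* Rintegral mu setT (fun x => complex.Im (f x)).

Lemma integrableZ_EFin (k : R) (f : T -> R) :
  mu.-integrable setT (EFin \o f) ->
  mu.-integrable setT (EFin \o (fun x => k * f x)).
Proof. by move=> /(integrableZl measurableT k). Qed.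

Lemma cintegralZ (k : C) f : cintegrable f ->
  cintegral (fun x => k * f x) = k * cintegral f.
Proof.
case: k => a b [f1 f2]; apply/eqP; rewrite eq_complex /=; apply/andP; split.
  rewrite -!RintegralZl// -RintegralB//; try exact: integrableZ_EFin.
  by apply/eqP/eq_Rintegral => x _; case: (f x).
rewrite -!RintegralZl// -RintegralD//; try exact: integrableZ_EFin.
by apply/eqP/eq_Rintegral => x _; case: (f x).
Qed.

Lemma cintegrableZ (k : C) f : cintegrable f -> cintegrable (fun x => k * f x).
Proof.
case: k => a b [f1 f2]; split.
  rewrite (_ : _ \o _ = ((EFin \o (fun x => a * complex.Re (f x))%R) \-
    (EFin \o (fun x => b * complex.Im (f x))%R))%E).
    by apply: integrableB => //; exact: integrableZ_EFin.
  by apply/funext => x /=; case: (f x).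
rewrite (_ : _ \o _ = ((EFin \o (fun x => a * complex.Im (f x))%R) \+
  (EFin \o (fun x => b * complex.Re (f x))%R))%E).
  by apply: integrableD => //; exact: integrableZ_EFin.
by apply/funext => x /=; case: (f x).
Qed.

Lemma cintegral_conj f : cintegrable f ->
  cintegral (fun x => conjc (f x)) = conjc (cintegral f).
Proof.
move=> [f1 f2]; rewrite /cintegral /=; congr (_ +i* _).
  by apply: eq_Rintegral => x _; case: (f x).
rewrite -mulN1r -RintegralZl//.
by apply: eq_Rintegral => x _; case: (f x) => ? ? /=; rewrite mulN1r.
Qed.

Lemma cintegral_cst1 (k : C) : mu setT = 1%E -> cintegral (fun=> k) = k.
Proof.
by move=> mu1; rewrite /cintegral !Rintegral_cst// mu1 !mulr1; case: k.
Qed.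

Lemma eq_cintegral f g : f =1 g -> cintegral f = cintegral g.
Proof. by move=> /funext->. Qed.

(** The modulus of [cexp z] is the exponential of the real part of z, so a bound on the latter
    dominates both components. *)
Lemma cintegrable_cexp (K : R) f (g : T -> R) : cmeasurable f ->
  (forall x, expR (complex.Re (f x)) <= K * g x) ->
  mu.-integrable setT (EFin \o g) -> cintegrable (fun x => cexp (f x)).
Proof.
move=> /cmeasurable_cexp[m1 m2] le_g intg.
have le (c x : R) : `|c| <= 1 -> `|expR x * c| <= expR x.
  by move=> c1; rewrite normrM ger0_norm ?expR_ge0// ler_piMr ?expR_ge0.
by split; apply: integrable_dominated intg => // x; apply: le_trans (le_g x);
  rewrite /cexp/= mul0r ?addr0 ?subr0; apply: le;
  rewrite ler_norml ?cos_geN1 ?cos_le1 ?sin_geN1 ?sin_le1.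
Qed.
End integral.

Section fubini.
Context d1 d2 (T1 : measurableType d1) (T2 : measurableType d2).
Variables (m1 : {sigma_finite_measure set T1 -> \bar R}).
Variables (m2 : {sigma_finite_measure set T2 -> \bar R}).

(** Integrability of every slice makes each inner integral finite, so that [fine] loses nothing. *)
Lemma Rintegral_prod (f : T1 * T2 -> R) :
  (m1 \x m2)%E.-integrable setT (EFin \o f) ->
  (forall y, m1.-integrable setT (EFin \o (fun x => f (x, y)))) ->
  Rintegral (m1 \x m2)%E setT f =
  Rintegral m2 setT (fun y => Rintegral m1 setT (fun x => f (x, y))).
Proof.
move=> intf intf1; rewrite /Rintegral -integral21_prod_meas1//.
congr fine; apply: eq_integral => y _; rewrite /fubini_G.
by rewrite fineK//; exact: (integrable_fin_num measurableT (intf1 y)).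
Qed.

Lemma cintegral_prod (f : T1 * T2 -> C) :
  cintegrable (m1 \x m2)%E f ->
  (forall y, cintegrable m1 (fun x => f (x, y))) ->
  cintegral (m1 \x m2)%E f =
  cintegral m2 (fun y => cintegral m1 (fun x => f (x, y))).
Proof.
move=> [f1 f2] intf1; rewrite /cintegral/=; congr (_ +i* _);
  by apply: Rintegral_prod => // y; case: (intf1 y).
Qed.
End fubini.

Section tuples.
Local Notation RT := (measurableTypeR R).
Local Notation lam :=
  [the {sigma_finite_measure set RT -> \bar R} of @lebesgue_measure R].
Variables (n : nat) (m : {sigma_finite_measure set (n.-tuple RT) -> \bar R}).

Lemma cintegrable_cons (f : n.+1.-tuple RT -> C) :
  cmeasurable f -> cintegrable (lam \x m)%E (f \o @cons_pair R n) ->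
  cintegrable (lebesgue_cons m) f.
Proof.
by move=> [m1 m2] [f1 f2]; split;
  apply: (integrable_pushforward (@measurable_cons_pair R n)) => //;
  exact/measurable_EFinP.
Qed.

Lemma cintegral_cons (f : n.+1.-tuple RT -> C) :
  cmeasurable f -> cintegrable (lam \x m)%E (f \o @cons_pair R n) ->
  cintegral (lebesgue_cons m) f = cintegral (lam \x m)%E (f \o @cons_pair R n).
Proof.
move=> [m1 m2] [f1 f2]; rewrite /cintegral /Rintegral.
rewrite (integral_pushforward (@measurable_cons_pair R n))//; last first.
  exact/measurable_EFinP.
rewrite (integral_pushforward (@measurable_cons_pair R n))//.
exact/measurable_EFinP.
Qed.
End tuples.
End complex_integral.

(** * Schur complements: completing the square in one variable *)

Lemma schur_square (F : fieldType) n (a : F) (b : 'cV[F]_n) (Z : 'M[F]_n)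
    (s : 'M[F]_1) (t : 'cV[F]_n) : a != 0 ->
  ((col_mx s t)^T *m block_mx a%:M b^T b Z *m col_mx s t) 0 0
  = a * (s 0 0 + a^-1 * (b^T *m t) 0 0) ^+ 2
    + (t^T *m (Z - a^-1 *: (b *m b^T)) *m t) 0 0.
Proof.
move=> a0; rewrite tr_col_mx mul_row_block mul_row_col.
have -> : t^T *m b = (b^T *m t)^T by rewrite trmx_mul trmxK.
rewrite mulmxBr mulmxBl -scalemxAr -scalemxAl !mulmxA.
have -> : t^T *m b *m b^T *m t = (b^T *m t)^T *m (b^T *m t).
  by rewrite trmx_mul trmxK !mulmxA.
rewrite !mulmxDl -[s^T *m b^T *m t]mulmxA.
rewrite [s]mx11_scalar [b^T *m t]mx11_scalar; set r := (b^T *m t) 0 0.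
rewrite !tr_scalar_mx -!scalar_mxM !mxE /= !mulr1n.
by set z := \sum_j _; field.
Qed.

(** Block elimination of the first column by a unipotent lower triangular factor. *)
Lemma schur_det (F : fieldType) n (a : F) (b : 'cV[F]_n) (Z : 'M[F]_n) :
  a != 0 ->
  \det (block_mx a%:M b^T b Z) = a * \det (Z - a^-1 *: (b *m b^T)).
Proof.
move=> a0.
have -> : block_mx a%:M b^T b Z = block_mx 1%:M 0 (a^-1 *: b) 1%:M
    *m block_mx a%:M b^T 0 (Z - a^-1 *: (b *m b^T)).
  rewrite mulmx_block !mul1mx !mul0mx !addr0 -!scalemxAl.
  by rewrite mul_mx_scalar scalerA mulVf// scale1r addrC subrK.
by rewrite det_mulmx det_lblock det_ublock !det1 det_scalar1 !mul1r.
Qed.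

(** * Gaussian integrals in several variables *)

Section gauss_space.
Context {R : realType}.
Local Notation C := R[i].
Local Notation RT := (measurableTypeR R).
Local Notation lam :=
  [the {sigma_finite_measure set RT -> \bar R} of @lebesgue_measure R].

Lemma cexp_real (x : R) : cexp x%:C = (expR x)%:C.
Proof.
by rewrite /cexp/= cos0 sin0; exact: mulr1.
Qed.

(** The real and imaginary parts are waves of phases 0 and - pi / 2, whose cosines are 1 and 0: the
    integral is real and independent of the centre. *)
Lemma cintegral_gauss1 (a : R) (z : C) : 0 < a ->
  let f (s : RT) := cexp (- (pi * a)%:C * (s%:C - z) ^+ 2) in
  cintegrable lam f /\ cintegral lam f = (Num.sqrt a)^-1%:C.
Proof.
case: z => p q a0 f.
have c0 : 0 < pi * a by rewrite mulr_gt0// pi_gt0.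
have fRe : (fun s => complex.Re (f s)) = gwave 0 (pi * a) p q.
  apply/funext => s; rewrite /f /cexp /gwave /= !expr2 /= !mul0r !subr0.
  by congr (expR _ * cos _); ring.
have fIm : (fun s => complex.Im (f s)) = gwave (- (pi / 2)) (pi * a) p q.
  apply/funext => s; rewrite /f /cexp /gwave /= !expr2 /= !mul0r !addr0.
  by rewrite cosBpihalf; congr (expR _ * sin _); ring.
split.
  by rewrite /cintegrable fRe fIm; split; exact: integrable_gwave.
rewrite /cintegral fRe fIm !Rintegral_gwave// cos0 cosN cos_pihalf mul0r mul1r.
rewrite (_ : pi / (pi * a) = a^-1) ?sqrtrV ?ltW//.
by rewrite invfM mulrA divff ?mul1r// gt_eqF ?pi_gt0.
Qed.

Definition posdef n (Y : 'M[R]_n) :=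
  Y^T = Y /\ forall x : 'cV[R]_n, x != 0 -> 0 < (x^T *m Y *m x) 0 0.

Definition cgauss n (Y : 'M[R]_n) (u : 'cV[C]_n) (x : 'cV[R]_n) : C :=
  cexp (- pi%:C * ((real_mx x - u)^T *m real_mx Y *m (real_mx x - u)) 0 0).

(** The cross terms between x - Re u and i Im u are purely imaginary. Hence the modulus of a
    Gaussian with complex centre is a constant times the Gaussian centred at Re u. *)
Lemma re_qform n (Y : 'M[R]_n) (x : 'cV[R]_n) (u : 'cV[C]_n) :
  complex.Re (((real_mx x - u)^T *m real_mx Y *m (real_mx x - u)) 0 0)
  = ((x - map_mx (@complex.Re R) u)^T *m Y
     *m (x - map_mx (@complex.Re R) u)) 0 0
    - ((map_mx (@complex.Im R) u)^T *m Y *m map_mx (@complex.Im R) u) 0 0.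
Proof.
set u1 := map_mx _ u; set u2 := map_mx (@complex.Im R) u.
have -> : real_mx x - u = real_mx (x - u1) - 'i%C *: real_mx u2.
  apply/matrixP => i j; rewrite !mxE; case: (u i j) => p q.
  by apply/eqP; rewrite eq_complex /=; apply/andP; split; apply/eqP; ring.
move: (x - u1) => y.
have -> : (real_mx y - 'i%C *: real_mx u2)^T
    = real_mx y^T - 'i%C *: real_mx u2^T.
  by apply/matrixP => i j; rewrite !mxE.
rewrite !(mulmxBl, mulmxBr).
rewrite /real_mx -!(scalemxAl, scalemxAr) scalerA -expr2 sqr_i scaleN1r.
rewrite -!map_mxM !mxE /=; ring.
Qed.

Lemma re_cgauss n (Y : 'M[R]_n) (u : 'cV[R]_n) x :
  cgauss Y (real_mx u) x
  = (expR (- pi * ((x - u)^T *m Y *m (x - u)) 0 0))%:C.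
Proof.
rewrite /cgauss /real_mx -map_mxB map_trmx -!map_mxM mxE -cexp_real.
by rewrite rmorphM rmorphN.
Qed.

Lemma cmeasurable_cgauss n (Y : 'M[R]_n) (u : 'cV[C]_n) :
  cmeasurable (fun t : n.-tuple RT =>
    - pi%:C * ((real_mx (\col_i tnth t i) - u)^T *m real_mx Y
               *m (real_mx (\col_i tnth t i) - u)) 0 0).
Proof.
apply: cmeasurableM; first exact: cmeasurable_cst.
pose w i (t : n.-tuple RT) : C := (tnth t i)%:C - u i 0.
rewrite (_ : (fun _ => _) = fun t =>
  \sum_j (\sum_i w i t * (Y i j)%:C) * w j t); last first.
  apply/funext => t; rewrite !mxE; apply: eq_bigr => j _; rewrite !mxE.
  by congr (_ * _); apply: eq_bigr => i _; rewrite !mxE.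
have mw i : cmeasurable (w i).
  apply: cmeasurableD; last exact: cmeasurable_cst.
  by apply: cmeasurable_real; exact: measurable_tnth.
apply: cmeasurable_sum => j; apply: cmeasurableM => //.
by apply: cmeasurable_sum => i; apply: cmeasurableM.
Qed.

(** The centre of the second factor moves with [t] and is complex even where it multiplies a
    one-dimensional Gaussian, but the integral over [s] does not depend on it; what remains is the
    Gaussian of the Schur complement. *)
Lemma cgauss_cons n (a : R) (b : 'cV[R]_n) (Z : 'M[R]_n) (u : 'cV[C]_(1 + n))
    (s : R) (t : 'cV[R]_n) : a != 0 ->
  let v := dsubmx u in
  cgauss (block_mx a%:M b^T b Z) u (col_mx s%:M t)
  = cgauss (Z - a^-1 *: (b *m b^T)) v t *
    cexp (- (pi * a)%:C *
      (s%:C - (u 0 0 - a^-1%:C * ((real_mx b)^T *m (real_mx t - v)) 0 0)) ^+ 2).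
Proof.
move=> a0 v; rewrite /cgauss -cexpD; congr cexp.
have -> : real_mx (col_mx s%:M t) - u
    = col_mx (real_mx s%:M - usubmx u) (real_mx t - v).
  by rewrite -{1}[u]vsubmxK opp_col_mx -add_col_mx /real_mx map_col_mx.
have -> : real_mx (block_mx a%:M b^T b Z)
    = block_mx (a%:C)%:M (real_mx b)^T (real_mx b) (real_mx Z).
  by rewrite /real_mx map_block_mx map_scalar_mx map_trmx.
rewrite schur_square; last by rewrite fmorph_eq0.
have -> : real_mx (Z - a^-1 *: (b *m b^T))
   = real_mx Z - (a%:C)^-1 *: (real_mx b *m (real_mx b)^T).
  by rewrite /real_mx map_mxB map_mxZ map_mxM map_trmx fmorphV.
set q := (_ *m _ *m (real_mx t - v)) 0 0.
set r := (_ *m (real_mx t - v)) 0 0.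
have -> : (real_mx s%:M - usubmx u) 0 0 = s%:C - u 0 0.
  by rewrite !mxE /= mulr1n; congr (_ - u _ _); apply: val_inj.
by rewrite fmorphV rmorphM; ring.
Qed.

(** The form is evaluated at the first basis vector, and at the vector over [t] for which the
    completed square vanishes. *)
Lemma posdef_schur n (a : R) (b : 'cV[R]_n) (Z : 'M[R]_n) :
  posdef (block_mx a%:M b^T b Z) -> 0 < a /\ posdef (Z - a^-1 *: (b *m b^T)).
Proof.
move=> [symY posY].
have a0 : 0 < a.
  have /posY : col_mx 1%:M 0 != 0 :> 'cV[R]_(1 + n).
    by rewrite col_mx_eq0 negb_and oner_eq0.
  rewrite tr_col_mx mul_row_block mul_row_col trmx0 trmx1 !mul0mx !mulmx0.
  by rewrite !addr0 mul1mx mulmx1 mxE mulr1n.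
split => //; split.
  have := symY; rewrite tr_block_mx => /eq_block_mx[_ _ _ symZ].
  by rewrite linearB linearZ /= trmx_mul trmxK symZ.
move=> t t0.
have /posY : col_mx (- (a^-1 *: (b^T *m t))) t != 0.
  by rewrite col_mx_eq0 negb_and t0 orbT.
rewrite schur_square ?gt_eqF//.
suff -> : (- (a^-1 *: (b^T *m t))) 0 0 + a^-1 * (b^T *m t) 0 0 = 0.
  by rewrite expr0n mulr0 add0r.
by rewrite !mxE addNr.
Qed.

Lemma col_tnth_cons n (p : RT * n.-tuple RT) :
  \col_i tnth (cons_pair p) i
  = col_mx p.1%:M (\col_i tnth p.2 i) :> 'cV[R]_(1 + n).
Proof.
apply/colP => i; rewrite mxE; case: (split_ordP i) => j ->.
  rewrite col_mxEu ord1 mxE mulr1n.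
  have -> : lshift n (0 : 'I_1) = ord0 by apply: (@ord_inj n.+1).
  by [].
rewrite col_mxEd mxE.
have -> : rshift 1 j = lift ord0 j by apply: (@ord_inj n.+1).
by rewrite tnthS.
Qed.

Lemma Re_realM (k : R) (z : C) : complex.Re (k%:C * z) = k * complex.Re z.
Proof. by case: z => x y /=; rewrite mul0r subr0. Qed.

(** In fact an equality, weakened to the shape of bound that [cintegrable_cexp] takes. *)
Lemma expR_re_cgauss n (Y : 'M[R]_n) (u : 'cV[C]_n) (x : 'cV[R]_n) :
  expR (complex.Re
    (- pi%:C * ((real_mx x - u)^T *m real_mx Y *m (real_mx x - u)) 0 0))
  <= expR (pi * ((map_mx (@complex.Im R) u)^T *m Y
                 *m map_mx (@complex.Im R) u) 0 0)
     * complex.Re (cgauss Y (real_mx (map_mx (@complex.Re R) u)) x).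
Proof.
rewrite re_cgauss -expRD ler_expR; set q := (_ *m _) 0 0.
have -> : complex.Re (- pi%:C * q) = - pi * complex.Re q.
  by case: q => ? ? /=; ring.
by rewrite re_qform le_eqVlt; apply/orP; left; apply/eqP; ring.
Qed.

Lemma block_mx_sym n (Y : 'M[R]_(1 + n)) : Y^T = Y ->
  exists (a : R) (b : 'cV[R]_n) (Z : 'M[R]_n), Y = block_mx a%:M b^T b Z.
Proof.
move=> symY; exists (Y 0 0), (dlsubmx Y), (drsubmx Y).
have := symY; rewrite -[in LHS](submxK Y) tr_block_mx -[RHS](submxK Y).
move=> /eq_block_mx[_ symb _ _]; rewrite -[LHS](submxK Y); congr block_mx.
  rewrite [LHS]mx11_scalar !mxE; congr (Y _ _)%:M; exact: (@ord_inj (1 + n)).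
by [].
Qed.

(** Induction on [n], integrating out the first coordinate. Positivity of the determinant comes out
    of the same recursion, det Y = a det S, and later makes Im T invertible. *)
Theorem cintegral_cgauss n (Y : 'M[R]_n) : posdef Y ->
  0 < \det Y /\ forall u : 'cV[C]_n,
  let f (t : n.-tuple RT) := cgauss Y u (\col_i tnth t i) in
  cintegrable (lebesgue_tuple n) f /\
  cintegral (lebesgue_tuple n) f = (Num.sqrt (\det Y))^-1%:C.
Proof.
elim: n Y => [|n IHn] Y posY.
  rewrite det_mx00; split => // u f.
  have -> : f = fun=> 1.
    by apply/funext => t; rewrite /f /cgauss mxE big_ord0 mulr0 cexp0.
  have mu1 : lebesgue_tuple 0 [set: 0.-tuple RT] = 1%E :> \bar R.
    transitivity (dirac ([tuple] : 0.-tuple RT) setT : \bar R) => //.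
    exact: diracT.
  split; first by split; exact: finite_measure_integrable_cst.
  by rewrite cintegral_cst1// sqrtr1 invr1.
have [a [b [Z YE]]] := block_mx_sym posY.1.
move: posY; rewrite YE => posY {YE}.
have [a0 posS] := posdef_schur posY.
have [detS intS] := IHn _ posS.
set Y' := block_mx _ _ _ _ in posY *; set S := Z - _ in posS detS intS *.
have detY : \det Y' = a * \det S by rewrite schur_det// gt_eqF.
split; first by rewrite detY mulr_gt0.
pose F u (t : n.+1.-tuple RT) := cgauss Y' u (\col_i tnth t i).
pose m := @lebesgue_tuple R n.
have mF u : cmeasurable (F u).
  exact/cmeasurable_cexp/(cmeasurable_cgauss Y').
have inner u t : cintegrable lam (fun s => F u (cons_pair (s, t))) /\
    cintegral lam (fun s => F u (cons_pair (s, t)))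
    = (Num.sqrt a)^-1%:C * cgauss S (dsubmx u) (\col_i tnth t i).
  pose z := u 0 0 - a^-1%:C *
    ((real_mx b)^T *m (real_mx (\col_i tnth t i) - dsubmx u)) 0 0.
  have -> : (fun s => F u (cons_pair (s, t))) = (fun s : RT =>
      cgauss S (dsubmx u) (\col_i tnth t i)
      * cexp (- (pi * a)%:C * (s%:C - z) ^+ 2)).
    by apply/funext => s; rewrite /F col_tnth_cons cgauss_cons ?gt_eqF.
  have [int1 int1E] := cintegral_gauss1 z a0.
  split; first exact: cintegrableZ.
  by rewrite (cintegralZ _ int1) int1E [RHS]mulrC.
(* With a real centre the integrand is positive, so Tonelli's theorem deduces integrability on the
   product from finiteness of the iterated integral. *)
have int_real (u1 : 'cV[R]_(1 + n)) : (lam \x m)%E.-integrable setT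
    (EFin \o (fun p => complex.Re (F (real_mx u1) (cons_pair p)))).
  have Fge0 t : 0 <= complex.Re (F (real_mx u1) t).
    by rewrite /F re_cgauss /= expR_ge0.
  apply/integrable21ltyP.
    apply/measurable_EFinP.
    by case: (cmeasurable_comp (@measurable_cons_pair R n) (mF (real_mx u1))).
  have [[intt _] _] := intS (dsubmx (real_mx u1)).
  have /(integrable_lty measurableT) := integrableZ_EFin (Num.sqrt a)^-1 intt.
  congr (_ < _)%E; apply: eq_integral => t _.
  rewrite [LHS]/comp -Re_realM -(inner (real_mx u1) t).2.
  have [int1 _] := (inner (real_mx u1) t).1.
  rewrite [complex.Re _]/=.
  rewrite fineK; last exact: (integrable_fin_num measurableT int1).
  apply: eq_integral => s _.
  by apply/esym/(congr1 EFin)/ger0_norm/Fge0.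
move=> u.
(* A complex centre costs only a constant factor against the real Gaussian centred at Re u. *)
have intF : cintegrable (lam \x m)%E (F u \o @cons_pair R n).
  apply: cintegrable_cexp (int_real (map_mx (@complex.Re R) u)) => [|p].
    exact: cmeasurable_comp (@measurable_cons_pair R n)
      (cmeasurable_cgauss Y' u).
  exact: expR_re_cgauss.
split; first exact: (cintegrable_cons (mF u) intF).
rewrite [LHS](cintegral_cons (mF u) intF) cintegral_prod//; last first.
  by move=> t; case: (inner u t).
under eq_cintegral => t do rewrite (inner u t).2.
have [intt inttE] := intS (dsubmx (u : 'cV_(1 + n))).
rewrite (cintegralZ _ intt) inttE detY sqrtrM ?ltW// invfM.
by rewrite rmorphM.
Qed.
End gauss_space.

(** * Theta series of a point of the Siegel space *)

Section bilinear.
Variables (F : comPzRingType) (n : nat).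
Implicit Types (a b : 'cV[F]_n) (M : 'M[F]_n).

(** Hides the matrix products, so that identities between quadratic forms become polynomial
    identities in a few scalars. *)
Definition bilmx a M b : F := (a^T *m M *m b) 0 0.

Lemma bilmxDl a a' M b : bilmx (a + a') M b = bilmx a M b + bilmx a' M b.
Proof. by rewrite /bilmx linearD /= !mulmxDl mxE. Qed.

Lemma bilmxDr a M b b' : bilmx a M (b + b') = bilmx a M b + bilmx a M b'.
Proof. by rewrite /bilmx !mulmxDr mxE. Qed.

Lemma bilmxZl k a M b : bilmx (k *: a) M b = k * bilmx a M b.
Proof. by rewrite /bilmx linearZ /= -!scalemxAl mxE. Qed.

Lemma bilmxZr k a M b : bilmx a M (k *: b) = k * bilmx a M b.
Proof. by rewrite /bilmx -!scalemxAr mxE. Qed.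

Lemma bilmxDm a M M' b : bilmx a (M + M') b = bilmx a M b + bilmx a M' b.
Proof. by rewrite /bilmx mulmxDr mulmxDl mxE. Qed.

Lemma bilmxZm k a M b : bilmx a (k *: M) b = k * bilmx a M b.
Proof. by rewrite /bilmx -scalemxAr -scalemxAl mxE. Qed.

Lemma bilmxC a M b : M^T = M -> bilmx a M b = bilmx b M a.
Proof.
move=> symM; rewrite /bilmx -[LHS]trace_mx11 -mxtrace_tr trace_mx11.
by rewrite !trmx_mul trmxK symM mulmxA.
Qed.

Lemma bilmxMr a M M' b : bilmx a M (M' *m b) = bilmx a (M *m M') b.
Proof. by rewrite /bilmx !mulmxA. Qed.

Lemma bilmx1 a b : bilmx a 1%:M b = (a^T *m b) 0 0.
Proof. by rewrite /bilmx mulmx1. Qed.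
End bilinear.

(** * The product of f_T with its Heisenberg translates as a Gaussian *)

Section siegel_gauss.
Context {R : realType} {N : nat}.
Local Notation C := R[i].
Variable (T : 'M[C]_N).
Hypothesis siegelT : siegel T.
Local Notation Y := (im_mx T).
Local Notation CT := (map_mx conjc T).
Local Notation CY := (real_mx Y).
Local Notation CYi := (real_mx (invmx Y)).

Lemma conj_cexp (z : C) : conjc (cexp z) = cexp (conjc z).
Proof.
case: z => a b; rewrite /cexp /= cosN sinN.
by apply/eqP; rewrite eq_complex /=; apply/andP; split; apply/eqP; ring.
Qed.

Lemma cexp_neq0 (z : C) : cexp z != 0.
Proof.
have : cexp z * cexp (- z) != 0 by rewrite -cexpD subrr cexp0 oner_eq0.
by rewrite mulf_eq0 negb_or => /andP[].
Qed.

Lemma conj_bilmx (a b : 'cV[C]_N) M :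
  conjc (bilmx a M b)
  = bilmx (map_mx conjc a) (map_mx conjc M) (map_mx conjc b).
Proof. by rewrite /bilmx map_trmx -!map_mxM [RHS]mxE. Qed.

Lemma conj_real_mx m n (M : 'M[R]_(m, n)) :
  map_mx conjc (real_mx M) = real_mx M.
Proof. by apply/matrixP => i j; rewrite !mxE; exact: conjc_real. Qed.

Lemma conj_mxK m n (M : 'M[C]_(m, n)) : map_mx conjc (map_mx conjc M) = M.
Proof. by apply/matrixP => i j; rewrite !mxE conjcK. Qed.

Lemma im_mx_posdef : posdef Y.
Proof.
have [symT posT] := siegelT; split => //.
by rewrite -[in RHS]symT map_trmx.
Qed.

Lemma det_im_mx_gt0 : 0 < \det Y.
Proof. by have [] := cintegral_cgauss im_mx_posdef. Qed.

Lemma mul_CY_CYi : CY *m CYi = 1%:M.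
Proof.
rewrite /real_mx -map_mxM mulmxV ?map_mx1//.
by rewrite unitmxE unitfE gt_eqF// det_im_mx_gt0.
Qed.

Lemma CYi_sym : CYi^T = CYi.
Proof. by rewrite map_trmx trmx_inv; case: im_mx_posdef => ->. Qed.

Lemma CT_sym : CT^T = CT.
Proof. by rewrite map_trmx siegelT.1. Qed.

Lemma T_CT : T = CT + (2 * 'i%C) *: CY.
Proof.
apply/matrixP => i j; rewrite !mxE; case: (T i j) => a b.
by apply/eqP; rewrite eq_complex /=; apply/andP; split; apply/eqP; ring.
Qed.

Lemma uline_conjE h : map_mx conjc (uline T h) = uline_conj T h.
Proof. by rewrite /uline /uline_conj map_mxD map_mxM !conj_real_mx. Qed.

Lemma hermE g h : herm T g h = bilmx (uline T g) CYi (uline_conj T h).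
Proof. by []. Qed.

Lemma conj_herm g h : conjc (herm T g h) = herm T h g.
Proof.
rewrite !hermE conj_bilmx -uline_conjE conj_mxK uline_conjE conj_real_mx.
by rewrite bilmxC// CYi_sym.
Qed.

Lemma uline_sub h :
  uline T h = uline_conj T h + (2 * 'i%C) *: (CY *m real_mx h.1).
Proof. by rewrite /uline {1}T_CT mulmxDl scalemxAl addrAC. Qed.

Lemma conjcM (z w : C) : conjc (z * w) = conjc z * conjc w.
Proof. exact: rmorphM. Qed.

(** In the exponent the quadratic term in x has matrix pi i (T - conj T) = - 2 pi Im T, and the
    linear one is - 2 pi i times the pairing of x with [uline_conj T h]. Completing the square gives
    the centre and leaves H(h,h) in the constant. *)
Lemma f_T_heis_act (h : V R N) (x : 'cV[R]_N) :
  f_T T x * conjc (heis_act (1, h) (f_T T) x)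
  = cexp (- (pi / 2)%:C * herm T h h)
    * cgauss (2 *: Y) (- ('i%C / 2) *: (CYi *m uline_conj T h)) x.
Proof.
rewrite /f_T /heis_act /cgauss mul1r conjcM !conj_cexp -!cexpD.
congr cexp.
rewrite -complexiE.
set a := real_mx x; set w := uline_conj T h.
have -> : real_mx (2 *: Y) = 2 *: CY by rewrite /real_mx map_mxZ rmorph_nat.
have -> : real_mx (x + h.1) = a + real_mx h.1 by rewrite /real_mx map_mxD.
have conj_real (r : R) : conjc ('i%C * r%:C) = - ('i%C * r%:C).
  by apply/eqP; rewrite eq_complex /=; apply/andP; split; apply/eqP; ring.
rewrite conj_real.
set b := real_mx h.1; set c := real_mx h.2.
have -> : ((2 * pi * (x^T *m h.2) 0 0 + pi * (h.1^T *m h.2) 0 0)%:C : C)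
  = 2 * pi%:C * bilmx a 1%:M c + pi%:C * bilmx b 1%:M c.
  rewrite !bilmx1 /a /b /c /real_mx !map_trmx -!map_mxM !mxE.
  by rewrite rmorphD !rmorphM rmorph_nat.
rewrite -/(bilmx a T a) -/(bilmx (a + b) T (a + b)) conjcM conj_real.
rewrite conj_bilmx map_mxD !conj_real_mx -/a -/b.
rewrite -/(bilmx (a - _ *: _) _ _) hermE uline_sub -/w -/b.
have -> : (pi / 2)%:C = pi%:C / 2 :> C by rewrite rmorphM fmorphV rmorph_nat.
set v := CYi *m w; set J := 'i%C.
have wE u : bilmx u 1%:M w = bilmx u CT b + bilmx u 1%:M c.
  by rewrite /w bilmxDr bilmxMr mul1mx.
(* From here on [w] is an atom, related to [b] and [c] by [wE] alone. *)
clearbody w.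
have -> : bilmx (w + (2 * J) *: (CY *m b)) CYi w
    = bilmx w CYi w + 2 * J * (bilmx b CT b + bilmx b 1%:M c).
  rewrite bilmxDl bilmxZl (bilmxC (CY *m b)) ?CYi_sym// bilmxMr.
  by rewrite (mulmx1C mul_CY_CYi) bilmxC ?trmx1// wE.
have -> : bilmx (a - - (J / 2) *: v) (2 *: CY) (a - - (J / 2) *: v)
    = 2 * (bilmx a CY a + J * (bilmx a CT b + bilmx a 1%:M c)
           + (J / 2) ^+ 2 * bilmx w CYi w).
  have CY_sym : CY^T = CY by rewrite map_trmx; case: im_mx_posdef => ->.
  have av : bilmx a CY v = bilmx a CT b + bilmx a 1%:M c.
    by rewrite /v bilmxMr mul_CY_CYi wE.
  have vv : bilmx v CY v = bilmx w CYi w.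
    by rewrite {2}/v bilmxMr mul_CY_CYi bilmxC ?trmx1// /v bilmxMr mul1mx.
  rewrite scaleNr opprK bilmxZm bilmxDl !bilmxDr !bilmxZl !bilmxZr.
  rewrite (bilmxC v a)// av vv; by field.
have -> : bilmx a T a = bilmx a CT a + 2 * J * bilmx a CY a.
  by rewrite {1}T_CT bilmxDm bilmxZm.
rewrite bilmxDl !bilmxDr (bilmxC b a) ?CT_sym//.
have J2 : J ^+ 2 + 1 = 0 by rewrite sqr_i addNr.
apply/eqP; rewrite -subr_eq0; apply/eqP.
move: (bilmx a CY a) (bilmx w CYi w) (bilmx a CT a) (bilmx a CT b)
  (bilmx b CT b) (bilmx a 1%:M c) (bilmx b 1%:M c) => y H q l m n k.
(* [field] treats [J] as an indeterminate; the relation J^2 = - 1 enters only through this factor,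
   whose cofactor collects the terms in [y] and [H]. *)
transitivity ((J ^+ 2 + 1) * (2 * pi%:C * y + pi%:C / 2 * H)).
  by field.
by rewrite J2 mul0r.
Qed.
End siegel_gauss.

(** * Coefficients of the theta series and their cocycle *)

Section siegel_theta.
Context {R : realType} {N : nat}.
Local Notation C := R[i].
Variable (T : 'M[C]_N).
Hypothesis siegelT : siegel T.

(** The Gaussian has matrix 2 Im T, whence the factor 2^N in the determinant. Integrability is
    recorded because conjugating the integral relies on it. *)
Let L2_f_T_cintegral (h : V R N) :
  let F (t : N.-tuple (measurableTypeR R)) :=
    f_T T (\col_i tnth t i)
    * conjc (heis_act (1, h) (f_T T) (\col_i tnth t i)) in
  cintegrable (lebesgue_tuple N) F /\
  cintegral (lebesgue_tuple N) F
  = (Num.sqrt (2 ^+ N * \det (im_mx T)))^-1%:C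
    * cexp (- (pi / 2)%:C * herm T h h).
Proof.
move=> F.
pose u := - ('i%C / 2) *: (real_mx (invmx (im_mx T)) *m uline_conj T h).
have -> : F = fun t => cexp (- (pi / 2)%:C * herm T h h)
    * cgauss (2 *: im_mx T) u (\col_i tnth t i).
  by apply/funext => t; rewrite /F f_T_heis_act.
have pos2 : posdef (2 *: im_mx T).
  have [symY posY] := im_mx_posdef siegelT.
  split; first by rewrite linearZ /= symY.
  by move=> x x0; rewrite -scalemxAr -scalemxAl mxE mulr_gt0 ?posY.
have [_ /(_ u)[intG G]] := cintegral_cgauss pos2.
split; first exact: cintegrableZ.
by rewrite (cintegralZ _ intG) G detZ mulrC.
Qed.

Lemma L2_f_T_heis_act (h : V R N) :
  L2_prod (f_T T) (heis_act (1, h) (f_T T))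
  = (Num.sqrt (2 ^+ N * \det (im_mx T)))^-1%:C
    * cexp (- (pi / 2)%:C * herm T h h).
Proof. by have [] := L2_f_T_cintegral h. Qed.

Lemma real_herm h : (complex.Re (herm T h h))%:C = herm T h h.
Proof.
have := conj_herm siegelT h h; case: (herm T h h) => a b [].
by move=> /eqP; rewrite eq_sym -addr_eq0 -mulr2n mulrn_eq0 /= => /eqP ->.
Qed.

(** The conjugate of the other product, whose value is real because H(h,h) is. *)
Lemma L2_heis_act_f_T (h : V R N) :
  L2_prod (heis_act (1, h) (f_T T)) (f_T T)
  = (Num.sqrt (2 ^+ N * \det (im_mx T)))^-1%:C
    * cexp (- (pi / 2)%:C * herm T h h).
Proof.
have [intF EF] := L2_f_T_cintegral h.
set k := _ * cexp _ in EF *.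
have <- : conjc k = k.
  rewrite /k conjcM conj_cexp -real_herm.
  by congr (_ * cexp _);
    apply/eqP; rewrite eq_complex /=; apply/andP; split; apply/eqP; ring.
rewrite -EF -cintegral_conj//.
by apply: eq_cintegral => t; rewrite conjcM conjcK mulrC.
Qed.

Lemma ulineD g h : uline T (g + h) = uline T g + uline T h.
Proof. by rewrite /uline /real_mx !map_mxD mulmxDr addrACA. Qed.

Lemma hermDl g g' h : herm T (g + g') h = herm T g h + herm T g' h.
Proof. by rewrite !hermE ulineD bilmxDl. Qed.

Definition re_herm g h : R := complex.Re (herm T g h).

Lemma re_hermC g h : re_herm g h = re_herm h g.
Proof. by rewrite /re_herm -(conj_herm siegelT h g); case: (herm T h g). Qed.

Lemma re_hermDl g g' h : re_herm (g + g') h = re_herm g h + re_herm g' h.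
Proof.
by rewrite /re_herm hermDl; case: (herm T g h) (herm T g' h) => ? ? [].
Qed.

Lemma re_hermDr g h h' : re_herm g (h + h') = re_herm g h + re_herm g h'.
Proof. by rewrite re_hermC re_hermDl !(re_hermC _ g). Qed.

Lemma pairADr (g h h' : V R N) : pairA g (h + h') = pairA g h + pairA g h'.
Proof. by rewrite /pairA /= !mulmxDr !mxE; ring. Qed.

(* The two phases e(g) and x_g^* cancel, so that the theta multiplier acts by
   a real cocycle. *)
Definition theta_cocycle (g h : V R N) : C :=
  cexp (- (pi / 2)%:C * herm T g g - (pi * complex.Re (herm T g h))%:C).

Lemma psi_theta_X g h :
  psi g h * cexp (theta_X T g h) = cexp (- (pi * complex.Re (herm T g h))%:C).
Proof. by rewrite /psi /theta_X -cexpD addrC subrK. Qed.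

Lemma conj_psi_theta_X g h :
  conjc (psi g h) * cexp (theta_X_dual T g h)
  = cexp (- (pi * complex.Re (herm T g h))%:C).
Proof.
rewrite /psi /theta_X_dual conj_cexp -cexpD -complexiE; congr cexp.
by apply/eqP; rewrite eq_complex /=; apply/andP; split; apply/eqP; ring.
Qed.

Lemma herm_re_herm h :
  - (pi / 2)%:C * herm T h h = (- (pi / 2 * re_herm h h))%:C.
Proof. by rewrite -real_herm mulNr -rmorphM -rmorphN. Qed.

Lemma theta_cocycleE g h :
  theta_cocycle g h
  = (expR (- (pi / 2 * re_herm g g) - pi * re_herm g h))%:C.
Proof. by rewrite /theta_cocycle herm_re_herm -rmorphB cexp_real. Qed.

(** This relation is what makes the multiplier a homomorphism. *)
Lemma theta_cocycleD a b h :
  theta_cocycle (a + b) h = theta_cocycle a (b + h) * theta_cocycle b h.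
Proof.
rewrite !theta_cocycleE -rmorphM -expRD; congr (expR _)%:C.
rewrite !(re_hermDl, re_hermDr) (re_hermC b a).
move: (re_herm a a) (re_herm a b) (re_herm b b) (re_herm a h) (re_herm b h).
by move=> *; field.
Qed.

(** The cocycle is the quotient of the coefficients at g + h and at h, which is the functional
    equation read coefficientwise. *)
Lemma theta_cocycle_series g h :
  theta_cocycle g h * cexp (- (pi / 2)%:C * herm T h h)
  = cexp (- (pi / 2)%:C * herm T (g + h) (g + h)).
Proof.
rewrite theta_cocycleE !herm_re_herm !cexp_real -rmorphM -expRD.
congr (expR _)%:C; rewrite !(re_hermDl, re_hermDr) (re_hermC h g).
by move: (re_herm g g) (re_herm g h) (re_herm h h) => *; field.
Qed.

Lemma theta_cocycle_neq0 g h : theta_cocycle g h != 0.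
Proof. exact: cexp_neq0. Qed.

(** Serves [theta_X] with k = - pi and [theta_X_dual] with k = pi. *)
Lemma theta_shift_additive (k : R) g h h' :
  - (pi * complex.Re (herm T g (h + h')))%:C + 'i * (k * pairA g (h + h'))%:C
  = (- (pi * complex.Re (herm T g h))%:C + 'i * (k * pairA g h)%:C)
    + (- (pi * complex.Re (herm T g h'))%:C + 'i * (k * pairA g h')%:C).
Proof.
rewrite -!/(re_herm _ _) re_hermDr pairADr !mulrDr !rmorphD mulrDr.
by rewrite opprD addrACA.
Qed.
End siegel_theta.

(** * Theta multipliers, for a lattice and its dual at once *)

Section theta_multipliers.
Context {R : realType} {N : nat}.
Local Notation C := R[i].
Variable (T : 'M[C]_N).
Hypothesis siegelT : siegel T.

Section generic.
Variables (D : zmodClosed (V R N)) (al : points D -> points D -> C).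
Variable X : V R N -> V R N -> C.
Hypothesis al0 : forall k, al k 0 = 1.
Hypothesis XD : forall g h h', X g (h + h') = X g h + X g h'.
Hypothesis alX : forall g h, al g h * cexp (X (val g) (val h))
  = cexp (- (pi * complex.Re (herm T (val g) (val h)))%:C).

Let L (g : points D) (Phi : formal C (points D)) :=
  theta_c T (val g) \*o e_mull al g
    (torus_shift (fun h => cexp (X (val g) (val h))) Phi).

Let valD (g h : points D) : val (g + h) = val g + val h.
Proof. by []. Qed.

Let val_split (k g : points D) : val k = val g + val (k - g).
Proof. by rewrite -[LHS]/(val k) -{1}[k](subrK g) valD addrC. Qed.

(** The pairing and the shift enter only through their product, which [alX] makes real: the operator
    translates by [g] and multiplies by the cocycle. *)
Let LE g Phi k :
  L g Phi k = theta_cocycle T (val g) (val (k - g)) * Phi (k - g).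
Proof.
rewrite /L /e_mull /torus_shift /= [al _ _ * _]mulrA alX mulrA.
by rewrite /theta_cocycle cexpD.
Qed.

Lemma theta_mult_series g : L g (theta_series T D) = theta_series T D.
Proof.
apply/funext => k; rewrite LE /theta_series mulrCA.
by rewrite (theta_cocycle_series siegelT) -val_split.
Qed.

(** The cocycle relation gives the homomorphism property; injectivity is read off the image of e(0),
    a nonzero multiple of e(g). *)
Lemma theta_mult_multiplier :
  (exists r, free_of_rank (points D) r) -> theta_multiplier al L.
Proof.
move=> [r freeD]; split.
- by exists r.
- move=> g.
  (* The right factor is e(0); dividing by it changes nothing since [al k 0] is 1. *)
  exists (theta_c T (val g)), g, 0, (fun h => cexp (X (val g) (val h))).
  split.
  + exact: cexp_neq0.
  + by split=> [h|h h']; [exact: cexp_neq0|rewrite -cexpD -XD valD].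
  + by move=> Phi; apply/funext => k; rewrite /e_divr /= addr0 al0 divr1.
- move=> a b; apply/funext => Phi; apply/funext => k /=; rewrite !LE mulrA.
  rewrite opprD addrA; congr (_ * _).
  by rewrite (val_split (k - a) b) valD (theta_cocycleD siegelT).
- move=> a b /(congr1 (fun f => f (e_gen 0) a)).
  rewrite !LE /e_gen subrr eqxx mulr1.
  have [/eqP|_] := eqVneq (a - b) 0; first by rewrite subr_eq0 => /eqP.
  by rewrite mulr0 => /eqP; rewrite (negbTE (theta_cocycle_neq0 _ _ _)).
Qed.
End generic.

Lemma pairA0 (g : V R N) : pairA g 0 = 0.
Proof. by rewrite /pairA !mulmx0 !mxE subrr. Qed.

Lemma alpha0 (D : zmodClosed (V R N)) (g : points D) : alpha g 0 = 1.
Proof. by rewrite /alpha /psi pairA0 !mulr0 cexp0. Qed.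

Lemma alpha_conj0 (D : zmodClosed (V R N)) (g : points D) : alpha_conj g 0 = 1.
Proof. by rewrite /alpha_conj alpha0 conjc1. Qed.

Lemma theta_XD g h h' : theta_X T g (h + h') = theta_X T g h + theta_X T g h'.
Proof.
have E u : theta_X T g u
    = - (pi * complex.Re (herm T g u))%:C + 'i * (- pi * pairA g u)%:C.
  by rewrite /theta_X mulNr rmorphN mulrN.
by rewrite !E; exact: theta_shift_additive.
Qed.

Lemma theta_X_dualD g h h' :
  theta_X_dual T g (h + h') = theta_X_dual T g h + theta_X_dual T g h'.
Proof. exact: theta_shift_additive. Qed.
End theta_multipliers.

(** * Lattices are free abelian groups of finite rank *)

Section free_subgroup.
Variable B : zmodType.

Lemma zmod_morph_Mz (f : B -> int) :
  {morph f : x y / x - y} -> forall x n, f (x *~ n) = f x * n.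
Proof.
move=> fB; pose g := HB.pack_for {additive B -> int} f
  (GRing.isZmodMorphism.Build _ _ f fB).
by move=> x n; rewrite -[f]/(g : B -> int) raddfMz -mulrzr intz.
Qed.

(** Induction on the number of coordinates: a basis of the kernel of the last one is completed by an
    element whose last coordinate generates the image. Taking a set [S] lets the induction pass to
    the kernel inside the same group. *)
Lemma free_subgroup m (f : nat -> B -> int) (S : set B) :
  (forall i, {morph f i : x y / x - y}) ->
  S 0 -> (forall x y, S x -> S y -> S (x - y)) ->
  (forall x, S x -> (forall i, (i < m)%N -> f i x = 0) -> x = 0) ->
  exists r, exists2 b : 'I_r -> B, (forall i, S (b i)) &
    forall x, S x -> exists! z : {ffun 'I_r -> int}, x = \sum_i b i *~ z i.
Proof.
move=> fB; elim: m S => [|m IHm] S S0 SB Sinj.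
  exists 0%N, (fun=> 0) => // x Sx; exists [ffun=> 0]; split=> [|z _].
    by rewrite big_ord0; apply: Sinj.
  by apply/ffunP => -[].
have f0 i : f i 0 = 0 by rewrite -(subrr 0) fB subrr.
pose K := S `&` [set x | f m x = 0].
have [||x [Sx fx0] fx|r [b Kb bP]] := IHm K.
- by split.
- by move=> x y [Sx fx] [Sy fy]; split; [exact: SB|rewrite /= fB fx fy subrr].
- apply: Sinj => // i; rewrite ltnS leq_eqVlt => /predU1P[->//|].
  exact: fx.
have [allK|] := pselect (forall x, S x -> f m x = 0).
  exists r, b => [i|x Sx]; first by case: (Kb i).
  by apply: bP; split => //; exact: allK.
move=> /existsNP[x1 /not_implyP[Sx1 fx1]].
(* The generator of the image is its least positive element; [x1] or its opposite shows that one
   exists. *)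
pose P (d : nat) := `[< (0 < d)%N /\ exists2 x, S x & f m x = d%:Z >].
have exP : exists d, P d.
  exists `|f m x1|%N; apply/asboolP; split.
    by rewrite absz_gt0; apply/eqP.
  have [fx1_ge0|fx1_lt0] := leP 0 (f m x1).
    by exists x1 => //; rewrite gez0_abs.
  exists (0 - x1); first exact: SB.
  by rewrite fB f0 sub0r ltz0_abs.
have [d /asboolP[d0 [x0 Sx0 fx0]] dmin] := ex_minnP exP.
have SMz x n : S x -> S (x *~ n).
  move=> Sx; have SN y : S y -> S (- y) by move=> Sy; rewrite -sub0r; exact: SB.
  have Sn k : S (x *+ k).
    elim: k => [//|k IH]; rewrite mulrS -[x *+ k]opprK; apply: SB => //.
    exact: SN.
  by case: n => k; [exact: Sn|exact/SN/Sn].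
(* Division with remainder: a nonzero remainder would be a positive value of [f m] on [S] below the
   least one. *)
have div x : S x -> exists q : int, K (x - x0 *~ q).
  move=> Sx; exists (f m x %/ d%:Z)%Z; split.
    by apply: SB => //; exact: SMz.
  rewrite /= fB zmod_morph_Mz// fx0 mulrC; set y := _ - _.
  have yE : y = (f m x %% d%:Z)%Z
    by rewrite /y {1}(divz_eq (f m x) d%:Z) addrC addKr.
  have y0 : 0 <= y by rewrite yE modz_ge0// eqz_nat -lt0n.
  apply/eqP/contraT => yn0.
  have : (d <= `|y|)%N.
    apply: dmin; apply/asboolP; split; first by rewrite absz_gt0.
    exists (x - x0 *~ (f m x %/ d%:Z)%Z); first by apply: SB => //; exact: SMz.
    by rewrite fB zmod_morph_Mz// fx0 mulrC gez0_abs.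
  by rewrite leqNgt -ltz_nat gez0_abs// {1}yE ltz_pmod.
exists r.+1, (fun i => if unlift ord0 i is Some j then b j else x0).
  by move=> i; case: unlift => // j; case: (Kb j).
move=> x Sx.
have sumE (z : {ffun 'I_r.+1 -> int}) :
    \sum_i (if unlift ord0 i is Some j then b j else x0) *~ z i
    = x0 *~ z ord0 + \sum_i b i *~ z (lift ord0 i).
  rewrite big_ord_recl unlift_none; congr (_ + _).
  by apply: eq_bigr => i _; rewrite liftK.
have fD u v : f m (u + v) = f m u + f m v.
  by rewrite -{1}[v]opprK fB -sub0r fB f0 sub0r opprK.
have fsum (z : 'I_r -> int) : f m (\sum_i b i *~ z i) = 0.
  elim/big_ind: _ => // [u v fu fv|i _]; first by rewrite fD fu fv.
  by rewrite zmod_morph_Mz//; case: (Kb i) => _ /= ->; rewrite mul0r.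
have [q Kq] := div x Sx; have [z [zE zuniq]] := bP _ Kq.
exists [ffun i => if unlift ord0 i is Some j then z j else q]; split.
  rewrite sumE ffunE unlift_none.
  under eq_bigr do rewrite ffunE liftK.
  by rewrite -zE addrC subrK.
move=> z'; rewrite sumE => xE.
(* Applying [f m] kills the kernel part and determines the coefficient of [x0]. *)
have qE : q = z' ord0.
  have := Kq.2; rewrite /= fB zmod_morph_Mz// {1}xE fD fsum addr0.
  rewrite zmod_morph_Mz// fx0 -mulrBr => /eqP.
  rewrite mulf_eq0 eqz_nat eqn0Ngt d0 /=.
  by rewrite subr_eq0 => /eqP.
have /ffunP zz' : z = [ffun i => z' (lift ord0 i)].
  apply: zuniq; under eq_bigr do rewrite ffunE.
  by rewrite qE xE addrC addKr.
apply/ffunP => i; rewrite ffunE; case: unliftP => [j|] -> //.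
by rewrite zz' ffunE.
Qed.

Lemma free_of_rank_embedding m (f : nat -> B -> int) :
  (forall i, {morph f i : x y / x - y}) ->
  (forall x, (forall i, (i < m)%N -> f i x = 0) -> x = 0) ->
  exists r, free_of_rank B r.
Proof.
move=> fB finj.
have [|r [b _ bP]] := @free_subgroup m f setT fB I (fun _ _ _ _ => I).
  by move=> x _; exact: finj.
by exists r, b => x; exact: bP.
Qed.
End free_subgroup.

(** * Cocompact subgroups contain a basis of the real vector space *)

Section lattice.
Context {R : realType} {N : nat}.
Local Notation C := R[i].
Local Notation V := (V R N).

Definition row_of_pair (x : V) : 'rV[R]_(N + N) := row_mx x.1^T x.2^T.

Lemma row_of_pairB x y : row_of_pair (x - y) = row_of_pair x - row_of_pair y.
Proof. by rewrite /row_of_pair opp_row_mx add_row_mx /= !linearB. Qed.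

Definition pair_of_row (v : 'rV[R]_(N + N)) : V := ((lsubmx v)^T, (rsubmx v)^T).

Lemma row_of_pairK : cancel row_of_pair pair_of_row.
Proof.
by case=> x y; rewrite /pair_of_row /row_of_pair row_mxKl row_mxKr !trmxK.
Qed.

Lemma pair_of_rowK : cancel pair_of_row row_of_pair.
Proof. by move=> v; rewrite /row_of_pair /pair_of_row /= !trmxK hsubmxK. Qed.

Lemma continuous_linear_functional (c : 'cV[R]_(N + N)) :
  continuous (fun x : V => (row_of_pair x *m c) 0 0).
Proof.
move=> x.
have cs n (g : V -> 'cV[R]_n) (d : 'cV[R]_n) : continuous g ->
    continuous (fun x : V => ((g x)^T *m d) 0 0).
  move=> cg.
  rewrite (_ : (fun _ => _) = fun z => \sum_i g z i 0 * d i 0); last first.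
    by apply/funext => z; rewrite mxE; apply: eq_bigr => i _; rewrite mxE.
  elim: (index_enum _) => [|i s IH].
    rewrite (_ : (fun _ => _) = cst 0); first by move=> z; exact: cvg_cst.
    by apply/funext => z; rewrite big_nil.
  rewrite (_ : (fun _ => _) =
    (fun z => g z i 0 * d i 0) \+ (fun z => \sum_(i <- s) g z i 0 * d i 0)).
    move=> z; apply: cvgD; last exact: IH.
    apply: cvgM; last exact: cvg_cst.
    exact: (continuous_comp (cg z) (@coord_continuous _ _ _ i 0 (g z))).
  by apply/funext => z; rewrite big_cons.
rewrite (_ : (fun _ => _) = (fun z : V => (z.1^T *m usubmx c) 0 0)
    \+ (fun z : V => (z.2^T *m dsubmx c) 0 0)); last first.
  by apply/funext => z; rewrite /row_of_pair -{1}[c]vsubmxK mul_row_col mxE.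
by apply: cvgD; apply: cs => z; [exact: cvg_fst|exact: cvg_snd].
Qed.

Lemma cocompact_functional_eq0 (D : zmodClosed V) (c : 'cV[R]_(N + N)) :
  compact [set: quotient_topology (Quotient.quot D)] ->
  (forall x, x \in D -> row_of_pair x *m c = 0) -> c = 0.
Proof.
move=> cptQ Dc.
pose l (x : V) : R := (row_of_pair x *m c) 0 0.
pose Q := quotient_topology (Quotient.quot D).
(* [repr] need not be continuous, but [l] takes equal values on all representatives of a class, so
   [g] is the continuous functional induced on the quotient. *)
pose g : Q -> R := l \o repr.
have lB x y : l (x - y) = l x - l y by rewrite /l row_of_pairB mulmxBl !mxE.
have piD x y :
    (\pi_(Quotient.quot D)%qT x == \pi_(Quotient.quot D)%qT y) = (x - y \in D).
  by rewrite eqmodE.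
have cg : continuous g.
  apply: repr_comp_continuous; first exact: continuous_linear_functional.
  move=> x y /eqP xy.
  have xyD : x - y \in D by rewrite -piD; apply/eqP; exact: xy.
  by rewrite -subr_eq0 -lB /l Dc// mxE.
have gl x : g (\pi_Q%qT x) = l x.
  apply/eqP; rewrite -subr_eq0 -lB /l Dc ?mxE//.
  by rewrite -piD; apply/eqP; exact: reprK.
have [M [_ Mg]] :=
  compact_bounded (continuous_compact (continuous_subspaceT cg) cptQ).
have {}Mg x : `|l x| <= `|M| + 1.
  apply: Mg; first by rewrite (le_lt_trans (ler_norm M))// ltrDl.
  by exists (\pi_Q%qT x).
apply/colP => i; rewrite mxE; apply/eqP/contraT => ci0.
(* Scaled so that [l x] is |M| + 2, beyond the bound |M| + 1. *)
pose x := pair_of_row ((`|M| + 2) / c i 0 *: delta_mx 0 i).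
have := Mg x; rewrite /l pair_of_rowK -scalemxAl -rowE !mxE divfK//.
rewrite ger0_norm ?addr_ge0//.
by rewrite lerD2l (ler_nat R 2 1).
Qed.

(** A finite family in [D] of maximal rank has all of [D] in its row space, and cocompactness then
    forces that rank to be full. *)
Lemma cocompact_basis (D : zmodClosed V) :
  compact [set: quotient_topology (Quotient.quot D)] ->
  exists2 b : 'I_(N + N) -> V, (forall i, b i \in D) &
    (\matrix_i row_of_pair (b i)) \in unitmx.
Proof.
move=> cptQ; set n := (N + N)%N.
pose P r := `[< exists k (b : 'I_k -> V), (forall i, b i \in D) /\
  \rank (\matrix_i row_of_pair (b i)) = r >].
have exP : exists r, P r.
  exists (\rank (\matrix_(i < 0) row_of_pair (0 : V))); apply/asboolP.
  by exists 0%N, (fun=> 0); split => // -[].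
have leP r : P r -> (r <= n)%N.
  by move=> /asboolP[k [b [_ <-]]]; exact: rank_leq_col.
have [r /asboolP[k [b [bD rb]]] rmax] := ex_maxnP exP leP.
set A := \matrix_i row_of_pair (b i) in rb.
have Dsub x : x \in D -> (row_of_pair x <= A)%MS.
  move=> xD; pose b' (i : 'I_(k + 1)) :=
    match fintype.split i with inl j => b j | inr _ => x end.
  have b'E : \matrix_i row_of_pair (b' i) = col_mx A (row_of_pair x).
    apply/row_matrixP => i; rewrite rowK /b'; case: (split_ordP i) => j ->.
      by rewrite rowKu rowK.
    by rewrite rowKd ord1 row_id.
  have : P (\rank (col_mx A (row_of_pair x))).
    apply/asboolP; exists (k + 1)%N, b'; split; last by rewrite b'E.
    by move=> i; rewrite /b'; case: fintype.split.
  move=> /rmax; rewrite -rb -addsmxE => le.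
  have : (A + row_of_pair x <= A)%MS.
    rewrite -(geq_leqif (mxrank_leqif_sup (addsmxSl A (row_of_pair x)))).
    exact: le.
  by rewrite addsmx_sub => /andP[].
(* Each column of the cokernel is a functional vanishing on the row space of [A], hence on [D]. *)
have cokA : cokermx A = 0.
  apply/matrixP => i j; rewrite [RHS]mxE.
  have -> : cokermx A i j = (col j (cokermx A)) i 0 by rewrite [RHS]mxE.
  rewrite (@cocompact_functional_eq0 D (col j (cokermx A)) cptQ) ?mxE//.
  move=> x /Dsub /submxP[u ->].
  by rewrite -mulmxA colE (mulmxA A) mulmx_coker mul0mx mulmx0.
have fullA : row_full A by rewrite -cokermx_eq0 cokA.
exists (b \o fullrankfun fullA) => [i|]; first exact: bD.
rewrite (_ : \matrix_i _ = rowsub (fullrankfun fullA) A); last first.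
  by apply/row_matrixP => i; rewrite rowK row_rowsub rowK.
exact: fullrowsub_unit.
Qed.
End lattice.

(** * Integrality from roots of unity, and simultaneous approximation *)

Section integrality.
Context {R : realType}.

Lemma sin_pi_int (z : int) : sin (pi * z%:~R) = 0 :> R.
Proof.
have sin_nat n : sin (pi * n%:R) = 0 :> R.
  elim: n => [|n IH]; first by rewrite mulr0 sin0.
  by rewrite -addn1 natrD mulrDr mulr1 sinDpi IH oppr0.
by case: z => n; [exact: sin_nat|rewrite NegzE mulrNz mulrN sinN sin_nat oppr0].
Qed.

(** Since cos (2 pi a) = 1 - 2 sin^2 (pi a), the sine vanishes at pi a, hence at pi t for the
    fractional part t of [a]; but it is positive on the open interval from 0 to pi. *)
Lemma cos_2pi_eq1 (a : R) : cos (2 * pi * a) = 1 -> a \is a Num.int.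
Proof.
have -> : 2 * pi * a = (pi * a) *+ 2 by ring.
rewrite cos_mulr2n cos2sin2 => /eqP cosa.
have : sin (pi * a) ^+ 2 = 0 by move: cosa => /eqP; lra.
move=> /eqP; rewrite sqrf_eq0 => /eqP sina.
pose t := a - (Num.floor a)%:~R.
have aE : pi * a = pi * t + pi * (Num.floor a)%:~R by rewrite -mulrDr subrK.
have cz0 : cos (pi * (Num.floor a)%:~R) != 0 :> R.
  have := cos2Dsin2 (pi * (Num.floor a)%:~R : R).
  rewrite sin_pi_int expr0n addr0 => c2; apply/eqP => c0.
  by move: c2; rewrite c0 expr0n => /esym/eqP; rewrite oner_eq0.
have sint : sin (pi * t) = 0.
  move: sina; rewrite aE sinD sin_pi_int mulr0 addr0 => /eqP.
  by rewrite mulf_eq0 (negbTE cz0) orbF => /eqP.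
have /andP[fa af] := floor_itv a.
have t0 : 0 <= t by rewrite subr_ge0.
have t1 : t < 1 by rewrite ltrBlDr addrC -intrD1.
have [t_gt0|] := ltP 0 t.
  have : 0 < sin (pi * t).
    by rewrite sin_gt0_pi// mulr_gt0 ?pi_gt0//= gtr_pMr ?pi_gt0.
  by rewrite sint ltxx.
move=> t_le0; have /eqP : t == 0 by rewrite eq_le t_le0.
by move=> /eqP; rewrite subr_eq0 => /eqP ->; exact: intr_int.
Qed.

(** Pigeonhole: among K^n + 1 multiples of [y] modulo 1, two lie in the same of the K^n cells of
    side 1 / K, and their difference is the required multiple. *)
Lemma dirichlet_approximation n (K : nat) (y : 'I_n -> R) : (0 < K)%N ->
  exists (d : nat) (m : 'I_n -> int),
    (0 < d <= K ^ n)%N /\ forall i, `|d%:R * y i - (m i)%:~R| < K%:R^-1.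
Proof.
case: K => // K _.
pose fr (k : nat) i := k%:R * y i - (Num.floor (k%:R * y i))%:~R.
have fr0 k i : 0 <= fr k i by rewrite subr_ge0 floor_le.
have fr1 k i : fr k i < 1.
  have /andP[_ lt] := floor_itv (k%:R * y i).
  by rewrite /fr ltrBlDr addrC -intrD1.
(* [inord] never falls back on its default, the scaled fractional parts being below [K.+1]. *)
pose cell (k : 'I_(K.+1 ^ n).+1) : {ffun 'I_n -> 'I_K.+1} :=
  [ffun i => inord (Num.truncn (K.+1%:R * fr k i))].
have [k1 [k2 [ltk eqk]]] : exists k1 k2 : 'I_(K.+1 ^ n).+1,
    (k1 < k2)%N /\ cell k1 = cell k2.
  apply: contrapT => no; have : injective cell.
    move=> k1 k2 eqk; apply: val_inj => /=; apply/eqP.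
    rewrite eqn_leq; apply/andP; split; rewrite leqNgt; apply/negP => lt.
      by apply: no; exists k2, k1.
    by apply: no; exists k1, k2.
  by move=> /leq_card; rewrite card_ffun !card_ord ltnn.
exists (k2 - k1)%N,
  (fun i => Num.floor (k2%:R * y i) - Num.floor (k1%:R * y i)).
split=> [|i].
  rewrite subn_gt0 ltk/= leq_subLR (leq_trans _ (leq_addl _ _))//.
  by rewrite -ltnS.
have -> : (k2 - k1)%N%:R * y i
    - (Num.floor (k2%:R * y i) - Num.floor (k1%:R * y i))%:~R
    = fr k2 i - fr k1 i.
  by rewrite natrB ?(ltnW ltk)// intrB /fr; ring.
have K0 : 0 < K.+1%:R :> R by rewrite ltr0n.
have cellE k : cell k i = Num.truncn (K.+1%:R * fr k i) :> nat.
  by rewrite ffunE inordK// truncn_lt_nat ?mulr_ge0// gtr_pMr.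
have := truncn_itv (mulr_ge0 (ltW K0) (fr0 k1 i)).
have := truncn_itv (mulr_ge0 (ltW K0) (fr0 k2 i)).
rewrite -!cellE eqk => /andP[a1 a2] /andP[b1 b2].
rewrite -(ltr_pM2l K0) divff ?gt_eqF//.
rewrite -[X in X * `|_|]gtr0_norm// -normrM mulrBr.
rewrite ltr_norml; move: a1 a2 b1 b2.
by rewrite -(natr1 (cell k2 i)) => *; apply/andP; split; lra.
Qed.
End integrality.

(** * Freeness of a lattice and of its dual *)

Section lattice_rank.
Context {R : realType} {N : nat}.
Local Notation C := R[i].
Local Notation V := (V R N).

Lemma free_of_rank_coordinates (D : zmodClosed V) m (c : 'I_m -> V -> R) :
  (forall i, {morph c i : x y / x - y}) ->
  (forall i x, x \in D -> c i x \is a Num.int) ->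
  (forall x, (forall i, c i x = 0) -> x = 0) ->
  exists r, free_of_rank (points D) r.
Proof.
move=> cB cint cinj.
(* [free_of_rank_embedding] takes coordinates indexed by nat; those from [m] on are set to 0. *)
pose f (i : nat) (x : points D) : int :=
  if insub i is Some j then Num.floor (c j (val x)) else 0.
have fE j (x : points D) : (Num.floor (c j (val x)))%:~R = c j (val x).
  by rewrite floorK// cint// (valP x).
apply: (@free_of_rank_embedding _ m f) => [i x y|x fx].
  rewrite /f; case: insub => [j|]; last by rewrite subrr.
  by apply: (@intr_inj R); rewrite intrB !fE -cB.
apply: val_inj; apply: cinj => j; have := fx j (ltn_ord j).
by rewrite /f valK => fx0; rewrite -fE fx0.
Qed.

Lemma cexp_i_real (r : R) : cexp ('i * r%:C) = cos r +i* sin r.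
Proof.
rewrite -complexiE /cexp.
have -> : complex.Re ('i%C * r%:C) = 0 by rewrite /=; ring.
have -> : complex.Im ('i%C * r%:C) = r by rewrite /=; ring.
by rewrite expR0; exact: mul1r.
Qed.

Lemma orth_pairA_int (D : zmodClosed V) h x :
  h \in D -> x \in orth D -> pairA h x \is a Num.int.
Proof.
move=> hD /asboolW /(_ h hD); rewrite /eps_pair cexp_i_real => -[cos1 _].
exact: cos_2pi_eq1.
Qed.

HB.instance Definition _ :=
  GRing.isZmodMorphism.Build V 'rV[R]_(N + N) row_of_pair row_of_pairB.

Lemma pairA_row (h x : V) :
  pairA h x = (row_of_pair h *m col_mx x.2 (- x.1)) 0 0.
Proof. by rewrite /row_of_pair mul_row_col mulmxN /pairA !mxE. Qed.

Lemma pairABr (g x y : V) : pairA g (x - y) = pairA g x - pairA g y.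
Proof. by rewrite /pairA /= !mulmxBr !mxE; ring. Qed.

(** The coordinates are the pairings with a basis contained in [D]: integral by duality, and jointly
    injective because they are the product of an invertible matrix with the column (x2, - x1). *)
Lemma free_of_rank_dual (D : zmodClosed V) :
  compact [set: quotient_topology (Quotient.quot D)] ->
  exists r, free_of_rank (points (dual_lattice D)) r.
Proof.
move=> /cocompact_basis[b bD unitB].
apply: (free_of_rank_coordinates (c := fun i => pairA (b i)))
  => [i x y|i x xD|x bx0].
- exact: pairABr.
- exact: orth_pairA_int.
have : (\matrix_i row_of_pair (b i)) *m col_mx x.2 (- x.1) = 0.
  apply/row_matrixP => i; rewrite row_mul rowK row0.
  by apply/rowP => j; rewrite ord1 [RHS]mxE -(bx0 i) pairA_row.
move=> /(congr1 (mulmx (invmx (\matrix_i row_of_pair (b i))))).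
rewrite mulKmx// mulmx0 -[RHS]col_mx0 => /eq_col_mx[x2 /eqP].
by rewrite oppr_eq0 => /eqP x1; rewrite [x]surjective_pairing x1 x2.
Qed.

Lemma isolated0_bound (D : zmodClosed V) :
  isolated [set x | x \in D] 0 ->
  exists2 e : R, 0 < e &
    forall h, h \in D -> (forall j, `|row_of_pair h 0 j| < e) -> h = 0.
Proof.
move=> [_ [W /nbhs_ballP[e /= e0 eW] WD]]; exists e => // h hD he.
suff : (W `&` [set x | x \in D]) h by rewrite WD.
split => //; apply: eW; split; split => //= i j;
  rewrite ord1 /ball /= mxE sub0r normrN.
  by have := he (lshift N i); rewrite /row_of_pair row_mxEl mxE.
by have := he (rshift N i); rewrite /row_of_pair row_mxEr mxE.
Qed.

(** The coordinates in the basis [b] need not be integers, but have denominators at most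
    [K ^ (N + N)], with [K] the same for all of [D]; the factorial [M] clears them all. *)
Lemma free_of_rank_lattice (D : zmodClosed V) : is_lattice D ->
  exists r, free_of_rank (points D) r.
Proof.
move=> [isoD /cocompact_basis[b bD unitB]].
have [e e0 eD] := isolated0_bound (isoD 0 (rpred0 D)).
set B := \matrix_i row_of_pair (b i) in unitB.
(* [S] bounds the sum of absolute values in every column of [B], and [K] is chosen so that S / K <
   e. *)
pose S := \sum_i \sum_j `|B i j|.
pose K := (Num.bound (S / e)).+1.
pose M := (K ^ (N + N))`!.
pose y x i := (row_of_pair x *m invmx B) 0 i.
have yB : forall i, {morph y ^~ i : x x' / x - x'}.
  by move=> i x x'; rewrite /y row_of_pairB mulmxBl !mxE.
have S0 : 0 <= S by apply: sumr_ge0 => i _; apply: sumr_ge0.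
have SK : S / K%:R < e.
  rewrite ltr_pdivrMr ?ltr0n// mulrC -ltr_pdivrMr//.
  by rewrite (lt_le_trans (archi_boundP _)) ?divr_ge0 ?(ltW e0)// ler_nat leqW.
apply: (free_of_rank_coordinates (c := fun i x => M%:R * y x i))
  => [i x x'|i x xD|x yx0].
- by rewrite yB mulrBr.
- (* Some multiple d x, with 0 < d <= K ^ (2N), is closer to the span of the b i
     than e, hence belongs to it; M is a multiple of every such d. *)
  have [d [m [/andP[d0 dK] dm]]] :=
    dirichlet_approximation (y x) (ltn0Sn _ : (0 < K)%N).
  pose h := x *+ d - \sum_i b i *~ m i.
  have hD : h \in D.
    by apply: rpredB; [exact: rpredMn|apply: rpred_sum => k _; exact: rpredMz].
  have hE : row_of_pair h = (\row_k (d%:R * y x k - (m k)%:~R)) *m B.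
    have -> : \row_k (d%:R * y x k - (m k)%:~R)
        = d%:R *: (row_of_pair x *m invmx B) - \row_k (m k)%:~R.
      by apply/rowP => k; rewrite !mxE /y !mxE.
    rewrite raddfB raddfMn raddf_sum mulmxBl -scalemxAl mulmxKV// scaler_nat.
    congr (_ - _); rewrite mulmx_sum_row; apply: eq_bigr => k _.
    by rewrite raddfMz mxE rowK scaler_int.
  (* The coordinates of [h] in the basis are below 1 / K in absolute value, so its entries are at
     most S / K, and discreteness applies. *)
  have h0 : h = 0.
    apply: eD => // j; apply: le_lt_trans SK.
    rewrite hE mxE (le_trans (ler_norm_sum _ _ _))// mulr_suml.
    apply: ler_sum => k _; rewrite normrM mxE mulrC.
    apply: ler_pM => //; last exact/ltW/dm.
    by rewrite (bigD1 j)//= lerDl sumr_ge0.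
  have : \row_k (d%:R * y x k - (m k)%:~R) = 0.
    rewrite -[LHS](mulmxK unitB) -hE h0 /row_of_pair.
    by rewrite !linear0 row_mx0 mul0mx.
  move=> /rowP /(_ i); rewrite !mxE => /eqP; rewrite subr_eq0 => /eqP dy.
  have /dvdnP[q ->] : (d %| M)%N by rewrite /M dvdn_fact// d0.
  by rewrite natrM -mulrA dy -[q%:R]/(q%:Z%:~R) -intrM intr_int.
have : row_of_pair x *m invmx B = 0.
  apply/rowP => i; have /eqP := yx0 i.
  rewrite mulf_eq0 pnatr_eq0 gtn_eqF ?fact_gt0//=.
  by move=> /eqP yi; rewrite [RHS]mxE.
move=> /(congr1 (mulmxr B)); rewrite /= mulmxKV// mul0mx => x0.
by rewrite -[x]row_of_pairK x0 /pair_of_row !linear0.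
Qed.
End lattice_rank.

Theorem theorem3p7 (R : realType) (N : nat) (D : zmodClosed (V R N))
    (T : 'M[R[i]]_N) :
  (1 <= N)%N -> is_lattice D -> siegel T ->
  let Theta := scal_left D (f_T T) (f_T T) in
  let Theta_dual := scal_right D (f_T T) (f_T T) in
  [/\ Theta = theta_series T D,
      Theta_dual = theta_series T (dual_lattice D),
      quantum_theta (@alpha R N D) (theta_mult T D) Theta /\
      quantum_theta (@alpha_conj R N (dual_lattice D))
        (theta_mult_dual T D) Theta_dual,
      forall g : points D,
        theta_c T (val g) \*o e_mull (@alpha R N D) g
          (torus_shift (fun h => cexp (theta_X T (val g) (val h))) Theta)
        = Theta &
      forall g : points (dual_lattice D),
        theta_c T (val g) \*o e_mull (@alpha_conj R N (dual_lattice D)) g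
          (torus_shift (fun h => cexp (theta_X_dual T (val g) (val h))) Theta_dual)
        = Theta_dual].
Proof.
move=> _ latD siegT Theta Theta_dual.
have ThetaE : Theta = theta_series T D.
  by apply/funext => h; exact: L2_f_T_heis_act.
have Theta_dualE : Theta_dual = theta_series T (dual_lattice D).
  by apply/funext => h; exact: L2_heis_act_f_T.
(* [theta_mult] and [theta_mult_dual] are both instances of the generic operator; invariance needs
   only these two cancellations of phases. *)
have alX (g h : points D) := psi_theta_X T (val g) (val h).
have alX_dual (g h : points (dual_lattice D)) :=
  conj_psi_theta_X T (val g) (val h).
have inv := theta_mult_series siegT alX.
have inv_dual := theta_mult_series siegT alX_dual.
rewrite ThetaE Theta_dualE; split; [by []|by []| |exact: inv|exact: inv_dual].
split; split; [|exact: inv| |exact: inv_dual].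
  apply: (theta_mult_multiplier siegT (@alpha0 R N D) (theta_XD siegT) alX).
  exact: free_of_rank_lattice.
apply: (theta_mult_multiplier siegT (@alpha_conj0 R N _)
  (theta_X_dualD siegT) alX_dual).
by apply: free_of_rank_dual; case: latD.
Qed.
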